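(* Let $\bar{\mathbf q}(t,\mathbf q_0)$ be the solution of the system of ODEs (ODE) given in the context with initial point $\mathbf q(0)=\mathbf q_0\in\mathcal S$. Then there exists a unique fixed point $\mathbf q^*=(q^*_{m,l},m\in\mathcal M,l\in\mathbb N_0)\in\mathcal S$ of (ODE), and it satisfies, for every $\mathbf q_0\in\mathcal S$, $$\lim_{t\to\infty}\bar{\mathbf q}(t,\mathbf q_0)=\mathbf q^*.$$
   Context: Parameters: integers $K,M\ge1$, $d\ge2$; $\mathcal K=\{1,\dots,K\}$, $\mathcal M=\{1,\dots,M\}$; constants $\lambda,\xi,u_m>0$; $w_k\in(0,1)$ with $\sum_kw_k=1$; $v_m\in(0,1)$ with $\sum_mv_m=1$; $\lambda\xi<\sum_mu_mv_m$. $\mathbb N_0=\mathbb N\cup\{0\}$. $\mathcal S=\{\mathbf q\in[0,1]^{M\times\mathbb N_0}:q_{m,0}=1,\ q_{m,l}\ge q_{m,l+1},\ \sum_{l}q_{m,l}<\infty\ \forall m,l\}$ with the $\ell_1$-topology. Underlying graph sequence: for each $N$, $G^N=(W^N,V^N,E^N)$ is a bipartite graph with $W^N=\{1,\dots,W(N)\}$ (dispatchers), $V^N=\{1,\dots,N\}$ (servers), $E^N\subseteq W^N\times V^N$, $W(N)/N\to\xi$; $W^N$ is partitioned into types $W^N_k$ with $|W^N_k|/W(N)\to w_k$; $V^N$ into types $V^N_m$ with $|V^N_m|/N\to v_m$. Let $\mathcal N^N_w(i)=\{j:(i,j)\in E^N\}$, $\delta^N_i=|\mathcal N^N_w(i)|$,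 $\deg^N_w(i,m)=|\{j\in V^N_m:(i,j)\in E^N\}|$, $\deg^N_v(k,j)=|\{i\in W^N_k:(i,j)\in E^N\}|$. Standing assumption 1 (Condition C): (a) for each $k,m$, $\lim_N|\{(i,j)\in W^N_k\times V^N_m:(i,j)\in E^N\}|/(|W^N_k||V^N_m|)=p_{k,m}\in[0,1]$; (b) for each $k,m$, $\frac{\max_{i\in W^N_k}\deg^N_w(i,m)}{\min_{i\in W^N_k}\deg^N_w(i,m)}\to1$ and $\frac{\max_{j\in V^N_m}\deg^N_v(k,j)}{\min_{j\in V^N_m}\deg^N_v(k,j)}\to1$. Put $\delta_k=\sum_mp_{k,m}v_m>0$. Standing assumption 2 (subcritical regime): $\rho^N\to\rho$ for some $\rho<1$, where $$\rho^N=\max_{\emptyset\ne U\subseteq V^N}\Big(\sum_{m\in\mathcal M}u_m|U\cap V^N_m|\Big)^{-1}\sum_{i\in W^N}\Big(\mathbf 1_{(\delta^N_i\ge d)}\lambda\frac{\binom{|U\cap\mathcal N^N_w(i)|}{d}}{\binom{\delta^N_i}{d}}+\mathbf 1_{(\delta^N_i<d)}\lambda\frac{|U\cap\mathcal N^N_w(i)|}{\delta^N_i}\Big).$$ (ODE): for all $m\in\mathcal M$, $q_{m,0}(t)=1$ and for all $l\in\mathbb N$, $$\frac{dq_{m,l}(t)}{dt}=-u_m\big(q_{m,l}(t)-q_{m,l+1}(t)\big)+\lambda\xi\big(q_{m,l-1}(t)-q_{m,l}(t)\big)\sum_{k\in\mathcal K}\frac{p_{k,m}w_k}{\delta_k}\,\frac{(\tilde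 q_{k,l-1}(t))^d-(\tilde q_{k,l}(t))^d}{\tilde q_{k,l-1}(t)-\tilde q_{k,l}(t)},$$ with $\tilde q_{k,l}=\sum_{m}\frac{v_mp_{k,m}}{\delta_k}q_{m,l}$; $\frac{a^d-b^d}{a-b}$ is read as $\sum_{r=0}^{d-1}a^rb^{d-1-r}$ (also when $a=b$). A fixed point is a $\mathbf q^*$ with $q^*_{m,0}=1$ at which all right-hand sides vanish. *)

(* Defs.v *)
From mathcomp Require Import all_boot all_order all_algebra.
From mathcomp Require Import all_classical all_reals all_analysis.
Import Order.TTheory GRing.Theory Num.Theory numFieldNormedType.Exports.

Set Implicit Arguments.
Unset Strict Implicit.
Unset Printing Implicit Defensive.

Local Open Scope classical_set_scope.
Local Open Scope ring_scope.

(* Dispatchers are 'I_W and servers 'I_N; the ordered partitions of the two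
   sides into (possibly empty) types are given by the type functions. *)
Record bipartite_graph (K M W N : nat) := BipartiteGraph {
  edges : {set 'I_W * 'I_N};
  wtype : 'I_W -> 'I_K;
  vtype : 'I_N -> 'I_M }.

Section Graph.
Variables (K M W N : nat) (G : bipartite_graph K M W N).

Definition Wset (k : 'I_K) : {set 'I_W} := [set i | wtype G i == k]%SET.
Definition Vset (m : 'I_M) : {set 'I_N} := [set j | vtype G j == m]%SET.

Definition Nw (i : 'I_W) : {set 'I_N} := [set j | (i, j) \in edges G]%SET.

Definition deltaN (i : 'I_W) : nat := #|Nw i|.

Definition deg_w (i : 'I_W) (m : 'I_M) : nat :=
  #|[set j in Vset m | (i, j) \in edges G]%SET|.

Definition deg_v (k : 'I_K) (j : 'I_N) : nat :=
  #|[set i in Wset k | (i, j) \in edges G]%SET|.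

Definition edges_between (k : 'I_K) (m : 'I_M) : {set 'I_W * 'I_N} :=
  [set e in edges G | (e.1 \in Wset k) && (e.2 \in Vset m)]%SET.

(* The default values N and W of the minima bound the corresponding degrees,
   so they only matter when the type class is empty. *)
Definition max_deg_w (k : 'I_K) (m : 'I_M) : nat :=
  \max_(i in Wset k) deg_w i m.
Definition min_deg_w (k : 'I_K) (m : 'I_M) : nat :=
  \big[minn/N]_(i in Wset k) deg_w i m.
Definition max_deg_v (k : 'I_K) (m : 'I_M) : nat :=
  \max_(j in Vset m) deg_v k j.
Definition min_deg_v (k : 'I_K) (m : 'I_M) : nat :=
  \big[minn/W]_(j in Vset m) deg_v k j.

(* All the quotients are nonnegative, so the default value 0 is harmless for
   N > 0.  An isolated dispatcher contributes 0 (0 / 0 = 0). *)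
Definition rhoN (R : realType) (d : nat) (lambda : R) (u : 'I_M -> R) : R :=
  \big[Num.max/0]_(U : {set 'I_N} | U != finset.set0)
    ((\sum_(m < M) u m * #|U :&: Vset m|%:R)^-1 *
     \sum_(i < W)
       (if (d <= deltaN i)%N
        then lambda * ('C(#|U :&: Nw i|, d)%:R / 'C(deltaN i, d)%:R)
        else lambda * (#|U :&: Nw i|%:R / (deltaN i)%:R))).

End Graph.

(* When all degrees in a class vanish (which is possible if p_{k,m} = 0), the
   quotient 0 / 0 of equal degrees is read as 1.  If only the minimum vanishes,
   the value is 0, which excludes convergence to 1 as +oo does. *)
Definition deg_ratio (R : realType) (dmax dmin : nat) : R :=
  if dmax == 0%N then 1 else dmax%:R / dmin%:R.

Definition condition_C (R : realType) (K M : nat) (W : nat -> nat)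
    (G : forall N, bipartite_graph K M (W N) N) (p : 'I_K -> 'I_M -> R) : Prop :=
  (forall k m, 0 <= p k m <= 1 /\
     (#|edges_between (G N) k m|%:R / (#|Wset (G N) k|%:R * #|Vset (G N) m|%:R) : R)
       @[N --> \oo] --> p k m) /\
  (forall k m,
     deg_ratio R (max_deg_w (G N) k m) (min_deg_w (G N) k m) @[N --> \oo] --> (1 : R) /\
     deg_ratio R (max_deg_v (G N) k m) (min_deg_v (G N) k m) @[N --> \oo] --> (1 : R)).

Section MeanField.
Variables (R : realType) (K M : nat).

Notation state := ('I_M -> nat -> R).

Definition in_S (q : state) : Prop :=
  forall m,
    [/\ forall l, 0 <= q m l <= 1,
        q m 0%N = 1,
        forall l, q m l.+1 <= q m l &
        (\sum_(0 <= l <oo) (q m l)%:E < +oo)%E].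

Definition l1_dist (q q' : state) : \bar R :=
  (\sum_(m < M) \sum_(0 <= l <oo) `|q m l - q' m l|%:E)%E.

Variables (d : nat) (lambda xi : R) (u v : 'I_M -> R) (w : 'I_K -> R).
Variable (p : 'I_K -> 'I_M -> R).

Definition delta (k : 'I_K) : R := \sum_(m < M) p k m * v m.

Definition qtilde (q : state) (k : 'I_K) (l : nat) : R :=
  \sum_(m < M) v m * p k m / delta k * q m l.

(* (a^d - b^d) / (a - b), extended continuously to a = b. *)
Definition pow_quotient (a b : R) : R :=
  \sum_(r < d) a ^+ r * b ^+ (d - 1 - r).

(* Only used for l >= 1. *)
Definition ode_rhs (q : state) (m : 'I_M) (l : nat) : R :=
  - u m * (q m l - q m l.+1) +
  lambda * xi * (q m l.-1 - q m l) *
  \sum_(k < K) p k m * w k / delta k *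
    pow_quotient (qtilde q k l.-1) (qtilde q k l).

Definition is_fixed_point (q : state) : Prop :=
  forall m, q m 0%N = 1 /\ forall l, (0 < l)%N -> ode_rhs q m l = 0.

(* S-valued trajectories on [0, +oo[ (values at negative times are irrelevant).
   The equations are required for t > 0, with continuity up to t = 0; since the
   right-hand sides are then continuous in t, the one-sided equations at t = 0
   follow. *)
Definition is_solution (q0 : state) (q : R -> state) : Prop :=
  [/\ q 0 = q0,
      forall t : R, 0 <= t -> in_S (q t),
      forall m l, {within `[0, +oo[, continuous (fun t : R => q t m l)} &
      forall m l, (0 < l)%N -> forall t : R, 0 < t ->
        is_derive t (1 : R) (fun s : R => q s m l) (ode_rhs (q t) m l)].

End MeanField.

(* Main.v *)
Require Import Defs.
From mathcomp Require Import all_boot all_order all_algebra.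
From mathcomp Require Import all_classical all_reals all_analysis.
From mathcomp Require Import ring lra zify.
Import Order.TTheory GRing.Theory Num.Theory numFieldNormedType.Exports.
Local Open Scope classical_set_scope.
Local Open Scope ring_scope.
Set Implicit Arguments.
Unset Strict Implicit.
Unset Printing Implicit Defensive.

(** Two structural properties of the vector field carry the proof. It is
    cooperative: raising the other coordinates can only raise the drift of a
    given one ([rhs_quasi_monotone]). And its weighted sum over the types
    telescopes along the levels ([mass_balance]): with
    [services q l = sum_m u_m v_m q_{m,l}] and
    [arrivals q l = lambda xi sum_k w_k qtilde_{k,l}^d], the [v]-mass at a level
    changes by a difference of arrivals minus a difference of services.

    The load condition enters through a single inequality. Applying the
    definition of [rhoN] to the set of all servers whose type lies in a given set
    and letting the graphs grow gives [arrivals <= rho * services] at the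
    vertices of the cube [0,1]^M ([subcritical_vertices]); the left side is
    convex and the right side linear, so it holds on the whole cube
    ([subcritical_cube]).

    Existence. The explicit Euler map with step [1 / rate] is monotone, so its
    iterates from the empty system increase. They are sub-equilibria with
    finitely many occupied levels, hence [services] at level [l + 1] is at most
    [arrivals] at level [l], hence at most [rho * services] at level [l]. The
    tails are therefore geometric uniformly in the iteration, and the limit is
    a fixed point in S ([qlim_in_S], [qlim_fixed]).

    Convergence. For two solutions [q] and [q'] let [x] be the positive part of
    [q - q'], coordinate by coordinate. Cooperativity bounds the right
    derivative of [x_{m,l}] by the difference of the fields at [max (q, q')]
    and at [q'] ([excess_slope]), and mass balance makes the sum of these
    differences telescope. Write [gap l = services x l] and let [surplus l]
    be the increment of [arrivals l] from [q'] to [max (q, q')]. If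
    [surplus l <= r_l gap l] and the weights satisfy [r_{l+1} a_{l+1} <= a_l],
    the functional [sum_l (a_0 + .. + a_l) sum_m v_m x_{m,l+1}] is nonincreasing,
    and it dissipates the gap at every level where the inequality is strict
    ([lyapunov_lim_growth]). Weights decaying geometrically up to a level [n]
    give convergence to zero of the gap at that level ([gap_vanishes]), with
    the roles of [q] and of the fixed point in either order.
    To pass to the l1-norm the tails of the excess above the fixed point must be
    small uniformly in time. There [r_l] tends to [rho < 1], because
    the fixed point is small at high levels ([surplus_le_sharp]), so constant
    weights are admissible from some level on; with [n] of them, [n] times
    the tail beyond level [n] is at most the initial value of the functional,
    which is [o(n)] ([excess_tail]). Below the fixed point the tails are
    dominated by those of the fixed point. Uniqueness is convergence of the
    constant trajectory. *)

(** * Growth bounds from one-sided slopes *)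

Section Slopes.
Variable R : realType.
Implicit Types (g x : R -> R) (t c : R).

(** An upper bound for the upper right Dini derivative. It is used instead of a
    derivative because positive parts have corners. *)
Definition right_slope_le g t c :=
  forall e : R, 0 < e -> \forall h \near 0^'+, g (t + h) - g t <= (c + e) * h.

Lemma right_slope_le_weaken g t c c' :
  c <= c' -> right_slope_le g t c -> right_slope_le g t c'.
Proof.
move=> cc' H e e0; near=> h.
have h0 : 0 < h by near: h; exact: nbhs_right_gt.
apply: (@le_trans _ _ ((c + e) * h)); first by near: h; exact: H.
by rewrite ler_pM2r// lerD2r.
Unshelve. all: by end_near. Qed.

Lemma right_slope_le_sum (I : finType) (g : I -> R -> R) (a c : I -> R) t :
  (forall i, 0 <= a i) -> (forall i, right_slope_le (g i) t (c i)) ->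
  right_slope_le (fun s => \sum_i a i * g i s) t (\sum_i a i * c i).
Proof.
move=> a0 H e e0.
pose A := \sum_i a i + 1.
have A0 : 0 < A by rewrite ltr_wpDl// sumr_ge0.
have eA : 0 < e / A by rewrite divr_gt0.
have near_all : \forall h \near (0:R)^'+,
    forall i, g i (t + h) - g i t <= (c i + e / A) * h.
  by apply: filter_forall => i; exact: H.
near=> h.
have h0 : 0 < h by near: h; exact: nbhs_right_gt.
have Hh : forall i, g i (t + h) - g i t <= (c i + e / A) * h by near: h.
rewrite -sumrB.
apply: (@le_trans _ _ (\sum_i a i * ((c i + e / A) * h))).
  by apply: ler_sum => i _; rewrite -mulrBr ler_wpM2l.
have -> : \sum_i a i * ((c i + e / A) * h)
        = (\sum_i a i * c i) * h + (\sum_i a i) * (e / A) * h.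
  by rewrite !mulr_suml -big_split /=; apply: eq_bigr => i _; ring.
rewrite mulrDl lerD2l ler_pM2r// mulrCA ler_piMr ?(ltW e0)//.
by rewrite ler_pdivrMr// mul1r /A lerDl.
Unshelve. all: by end_near. Qed.

Lemma derive_near_right x t c (e : R) : is_derive t (1 : R) x c -> 0 < e ->
  \forall h \near 0^'+, `|x (t + h) - x t - c * h| <= e * h.
Proof.
move=> [dx Dx] e0.
have /cvg_dnbhs_at_right Hc :
    (fun h : R => h^-1 *: ((x \o shift t) (h *: (1:R)) - x t)) @ 0^' --> c.
  by rewrite -Dx; exact: dx.
move/cvgrPdist_le : Hc => /(_ e e0) H.
near=> h.
have h0 : 0 < h by near: h; exact: nbhs_right_gt.
have : `|c - h^-1 *: ((x \o shift t) (h *: (1:R)) - x t)| <= e by near: h.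
rewrite /= /GRing.scale /= mulr1 (addrC h t) => Hh.
have -> : x (t + h) - x t - c * h = - ((c - h^-1 * (x (t + h) - x t)) * h).
  by field; rewrite gt_eqF.
by rewrite normrN normrM (gtr0_norm h0) ler_pM2r.
Unshelve. all: by end_near. Qed.

Lemma right_slope_le_derive x t c :
  is_derive t (1 : R) x c -> right_slope_le x t c.
Proof.
move=> dx e e0; near=> h.
have : `|x (t + h) - x t - c * h| <= e * h by near: h; exact: derive_near_right.
move/(le_trans (ler_norm _)); lra.
Unshelve. all: by end_near. Qed.

(** At a zero of [x] the positive part has right slope [max c 0]; the two
    hypotheses overlap there, so [F] dominates both candidates. *)
Lemma right_slope_le_pos x t c F :
  is_derive t (1 : R) x c -> (0 <= x t -> c <= F) -> (x t <= 0 -> 0 <= F) ->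
  right_slope_le (fun s => Num.max (x s) 0) t F.
Proof.
move=> dx cF F0 e e0.
have xc : {for t, continuous x}.
  by apply/differentiable_continuous/derivable1_diffP; case: dx.
have xt : x (t + h) @[h --> 0^'+] --> x t.
  have th : t + h @[h --> (0:R)^'+] --> t.
    apply: cvg_at_right_filter; rewrite -[X in _ --> X]addr0.
    by apply: cvgD; [exact: cvg_cst|exact: cvg_id].
  exact: (cvg_comp _ _ th xc).
case: (ltrgtP (x t) 0) => xt0.
- have F0' : 0 <= F by apply: F0; exact: ltW.
  near=> h.
  have h0 : 0 < h by near: h; exact: nbhs_right_gt.
  have : x (t + h) < 0 by near: h; exact: (cvgr_lt (x t)).
  move=> /ltW /max_idPr ->; rewrite subrr mulr_ge0 ?ltW//; lra.
- have F0' : c <= F by apply: cF; exact: ltW.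
  near=> h.
  have h0 : 0 < h by near: h; exact: nbhs_right_gt.
  have : 0 < x (t + h) by near: h; exact: (cvgr_gt (x t)).
  move=> /ltW /max_idPl ->.
  have : x (t + h) - x t <= (c + e) * h by near: h; exact: right_slope_le_derive.
  by move/le_trans; apply; rewrite ler_pM2r//; lra.
- have F0' : 0 <= F by apply: F0; rewrite xt0.
  have F1' : c <= F by apply: cF; rewrite xt0.
  near=> h.
  have h0 : 0 < h by near: h; exact: nbhs_right_gt.
  have : x (t + h) - x t <= (c + e) * h by near: h; exact: right_slope_le_derive.
  rewrite xt0 !subr0 => H; rewrite ge_max; apply/andP; split.
    by apply: (le_trans H); rewrite ler_pM2r//; lra.
  rewrite mulr_ge0//; lra.
Unshelve. all: by end_near. Qed.

(** A mean value inequality needing only a slope bound at interior points: past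
    the last time at which the bound (relaxed by [e]) holds, the slope there
    would let it hold a little longer. *)
Lemma slope_le_growth g (s t c : R) : {within `[0, +oo[, continuous g} ->
  0 <= s -> s <= t -> (forall r, s < r -> r < t -> right_slope_le g r c) ->
  g t <= g s + c * (t - s).
Proof.
move=> gc s0; rewrite le_eqVlt => /predU1P[<- _|st slope]; first by rewrite subrr mulr0 addr0.
have [gin g0] := (continuous_within_itvcyP 0 g).1 gc.
have gcont r : 0 < r -> {for r, continuous g}.
  by move=> r0; apply: gin; rewrite in_itv/= andbT.
have gs : g r @[r --> s^'+] --> g s.
  move: s0; rewrite le_eqVlt => /predU1P[<-//|s0].
  by apply: cvg_at_right_filter; exact: gcont.
suff main e : 0 < e -> g t <= g s + (c + e) * (t - s) + e.
  apply/ler_addgt0Pr => e e0.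
  have k0 : 0 < t - s + 1 by lra.
  have := main (e / (t - s + 1)) (divr_gt0 e0 k0).
  move/le_trans; apply; rewrite -subr_ge0.
  have -> : g s + c * (t - s) + e -
    (g s + (c + e / (t - s + 1)) * (t - s) + e / (t - s + 1)) = 0.
    by field; rewrite gt_eqF.
  by [].
move=> e0.
pose h r := g r - g s - (c + e) * (r - s) - e.
suff : h t <= 0 by rewrite /h; lra.
have hc r : 0 < r -> {for r, continuous h}.
  move=> r0; apply: cvgB; last exact: cvg_cst.
  apply: cvgB; first by apply: cvgB; [exact: gcont|exact: cvg_cst].
  by apply: cvgMr; apply: cvgB; [exact: cvg_id|exact: cvg_cst].
have hs : h r @[r --> s^'+] --> - e.
  have -> : - e = g s - g s - (c + e) * (s - s) - e by ring.
  apply: cvgB; last exact: cvg_cst.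
  apply: cvgB; first by apply: cvgB; [exact: gs|exact: cvg_cst].
  apply: cvgMr; apply: cvgB; last exact: cvg_cst.
  by apply: cvg_at_right_filter; exact: cvg_id.
pose S := [set r | s < r <= t /\ h r <= 0].
(* The slack [e] keeps [h] negative just after [s], where no slope is assumed. *)
have S0 : S !=set0.
  suff : \forall r \near s^'+, s < r <= t /\ h r <= 0 by exact: filter_ex.
  near=> r; split.
    apply/andP; split; near: r; first exact: nbhs_right_gt.
    exact: nbhs_right_le.
  apply/ltW; near: r; apply: (cvgr_lt (- e)) => //; lra.
have Sub : has_ubound S by exists t => r [/andP[]].
have [r0 r0S] := S0; have [/andP[sr0 r0t] hr0] := r0S.
set z := sup S.
have sz : s < z by exact: (lt_le_trans sr0 (ub_le_sup Sub r0S)).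
have zt : z <= t by apply: ge_sup => // r [/andP[]].
have z0 : 0 < z by exact: le_lt_trans sz.
have hz : h z <= 0.
  rewrite leNgt; apply/negP => hz.
  have : \forall r \near z, 0 < h r by exact: (cvgr_gt (h z) (hc z z0) _ hz).
  move=> /nbhs_ballP[d /= d0 Hd].
  have [r Sr zr] := sup_adherent d0 (conj S0 Sub).
  have rz : r <= z by exact: (ub_le_sup Sub Sr).
  have : 0 < h r.
    by apply: Hd; rewrite /ball/= ger0_norm ?subr_ge0// ltrBlDl -ltrBlDr.
  by case: Sr => _ hr; rewrite ltNge hr.
move: zt; rewrite le_eqVlt => /predU1P[<-//|zt].
have : \forall d \near 0^'+, z < z + d <= t /\ h (z + d) <= 0.
  near=> d.
  have d0 : 0 < d by near: d; exact: nbhs_right_gt.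
  have dt : d <= t - z by near: d; apply: nbhs_right_le; lra.
  have : g (z + d) - g z <= (c + e) * d by near: d; exact: slope.
  split; first by apply/andP; split; lra.
  have := hz; rewrite /h; lra.
move=> /filter_ex[d [/andP[zd dt] hd]].
have Sd : S (z + d) by split => //; apply/andP; split => //; lra.
have : z + d <= z := ub_le_sup Sub Sd.
by rewrite leNgt zd.
Unshelve. all: by end_near. Qed.

End Slopes.

Section Dissipation.
Variable R : realType.

(** A nonnegative functional cannot keep losing a fixed amount. If the
    Lipschitz function [G] exceeds [e] at a late time it exceeds [e / 2] during
    a time [e / (2 * L)], and [J] then falls by [e ^+ 2 / (4 * L)], which is
    more than what separates it from its infimum. *)
Lemma dissipation_vanishes (J G : R -> R) (L : R) : 0 < L ->
  (forall t, 0 <= t -> 0 <= J t) -> (forall t, 0 <= t -> 0 <= G t) ->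
  (forall s t, 0 <= s -> s <= t -> `|G t - G s| <= L * (t - s)) ->
  (forall y s t, 0 <= y -> 0 <= s -> s <= t ->
    (forall r, s <= r -> r <= t -> y <= G r) -> J t <= J s - y * (t - s)) ->
  forall e, 0 < e -> exists2 T, 0 <= T & forall t, T <= t -> G t <= e.
Proof.
move=> L0 J0 G0 GL JG e e0.
pose E := [set J t | t in [set t | 0 <= t]].
have hE : has_inf E.
  by split; [exists (J 0), 0 => //=|exists 0 => _ [t t0 <-]; exact: J0].
pose eta := e ^+ 2 / (4 * L).
have eta0 : 0 < eta by rewrite divr_gt0 ?exprn_gt0// mulr_gt0.
have [_ [T T0 <-] JT] := inf_adherent eta0 hE.
exists T => // t Tt; rewrite leNgt; apply/negP => Gt.
have t0 : 0 <= t by exact: le_trans Tt.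
pose t' := t + e / (2 * L).
have tt' : t <= t' by rewrite lerDl divr_ge0 ?(ltW e0)// mulr_ge0// ltW.
have Jdrop : J t' <= J t - (e / 2) * (t' - t).
  apply: JG => // [|r tr rt']; first by rewrite divr_ge0// ltW.
  have : L * (r - t) <= e / 2.
    have -> : e / 2 = L * (t' - t) by rewrite /t'; field; rewrite gt_eqF.
    by rewrite ler_pM2l// lerD2r.
  have := GL _ _ t0 tr; rewrite ler_norml => /andP[]; lra.
have Jmon : J t <= J T.
  have := JG 0 T t (lexx 0) T0 Tt (fun r Tr _ => G0 r (le_trans T0 Tr)).
  by rewrite mul0r subr0.
have : inf E <= J t'.
  by apply: ge_inf; [case: hE|exists t' => //=; exact: le_trans tt'].
have e2 : (e / 2) * (t' - t) = eta by rewrite /t' /eta; field; rewrite gt_eqF.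
lra.
Qed.

End Dissipation.
(** * Sequences, series and elementary inequalities *)

Section Auxiliary.
Variable R : realType.

Lemma within_lincomb (I : finType) (A : set R) (a : I -> R) (f : I -> R -> R) :
  (forall i, {within A, continuous (f i)}) ->
  {within A, continuous (fun s => \sum_i a i * f i s)}.
Proof.
move=> fc x; apply: (@cvg_big _ _ +%R) => [z|i _].
  by apply: cvgD; [exact: cvg_fst|exact: cvg_snd].
apply: cvgM; [exact: cvg_cst|exact: fc].
Qed.

Lemma within_pos (A : set R) (f : R -> R) :
  {within A, continuous f} ->
  {within A, continuous (fun s => Num.max (f s) 0)}.
Proof.
move=> fc.
have -> : (fun s => Num.max (f s) 0) = (fun s => (f s + `|f s|) / 2).
  by apply/funext => s; rewrite maxr_absE subr0 addr0.
move=> x; apply: cvgM; last exact: cvg_cst.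
by apply: cvgD; [exact: fc|apply: cvg_norm; exact: fc].
Qed.

Lemma bounded_series_is_cvg (a : nat -> R) (c : R) : (forall l, 0 <= a l) ->
  (forall n, \sum_(0 <= l < n) a l <= c) -> cvgn (series a).
Proof.
move=> a0 ac; apply: nondecreasing_is_cvgn.
  apply/nondecreasing_seqP => n.
  by rewrite /series/= big_nat_recr//= lerDl.
by exists c => _ [n _ <-]; exact: ac.
Qed.

Lemma bounded_series_cvg0 (a : nat -> R) (c : R) : (forall l, 0 <= a l) ->
  (forall n, \sum_(0 <= l < n) a l <= c) -> a l @[l --> \oo] --> 0.
Proof. by move=> a0 ac; apply: cvg_series_cvg_0; exact: bounded_series_is_cvg ac. Qed.

Lemma bounded_series_tail (a : nat -> R) (c e : R) : (forall l, 0 <= a l) ->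
  (forall n, \sum_(0 <= l < n) a l <= c) -> 0 < e ->
  exists L, forall n, \sum_(L <= l < n) a l <= e.
Proof.
move=> a0 ac e0; pose E := range (fun n => \sum_(0 <= l < n) a l).
have hE : has_sup E.
  split; first by exists (\sum_(0 <= l < 0) a l), 0%N.
  by exists c => _ [n _ <-]; exact: ac.
have [_ [L _ <-] HL] := sup_adherent e0 hE.
exists L => n; case: (leqP n L) => nL; first by rewrite big_geq// ltW.
have : \sum_(0 <= l < n) a l <= sup E by apply: ub_le_sup; [case: hE|exists n].
rewrite (big_cat_nat (leq0n L) (ltnW nL))/=; lra.
Qed.

Lemma summation_by_parts (a h : nat -> R) N :
  \sum_(l < N) (\sum_(j < l.+1) a j) * (h l - h l.+1) =
  \sum_(l < N) a l * h l - (\sum_(j < N) a j) * h N.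
Proof.
elim: N => [|N IH]; first by rewrite !big_ord0 mul0r subr0.
by rewrite !big_ord_recr/= IH; ring.
Qed.

(** The recursion convolves the summable sequence [b] with a geometric one, so
    [z] is summable too. *)
Lemma halving_cvg0 (b : nat -> R) (c : R) (z : nat -> R) : (forall l, 0 <= b l) ->
  (forall n, \sum_(0 <= l < n) b l <= c) -> z 0%N = b 0%N ->
  (forall l, z l.+1 = b l.+1 + z l / 2) ->
  (forall l, 0 <= z l) /\ z l @[l --> \oo] --> 0.
Proof.
move=> b0 bc z0 zS.
have zge l : 0 <= z l by elim: l => [|l IH]; rewrite ?z0// zS addr_ge0// divr_ge0.
split=> //; apply: (@bounded_series_cvg0 _ (2 * c)) => // n.
pose S (f : nat -> R) k := \sum_(0 <= l < k) f l.
have SS f k : S f k.+1 = S f k + f k by rewrite /S big_nat_recr.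
suff H : S z n.+1 <= S b n.+1 + S z n / 2.
  by have := bc n.+1; have := zge n; move: H; rewrite -!/(S _ _) !SS; lra.
elim: n => [|n IH]; first by rewrite !SS /S !big_nil mul0r z0 addr0.
by rewrite (SS z n.+1) (SS b n.+1) [S z n.+1 in X in _ <= X]SS zS; lra.
Qed.

(** The mixed terms of the binomial expansion all contain [b * x], so to leading
    order the increment for small [b] is the pure power [x ^+ n.+1]. *)
Lemma pow_increment (b x : R) n : 0 <= b -> 0 <= x -> b + x <= 1 ->
  (b + x) ^+ n.+1 - b ^+ n.+1 <= x ^+ n.+1 + 2 * n.+1%:R * (b * x).
Proof.
move=> b0 x0 bx1; have bx0 : 0 <= b * x by rewrite mulr_ge0.
elim: n => [|n IH]; first by rewrite !expr1; lra.
have hb : b ^+ n.+1 * x <= b * x.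
  by rewrite ler_wpM2r// exprS ler_piMr// exprn_ile1//; lra.
have hx : x ^+ n.+1 * b <= b * x.
  by rewrite (mulrC b) ler_wpM2r// exprS ler_piMr// exprn_ile1//; lra.
have hs : 2 * n.+1%:R * (b * x) * (b + x) <= 2 * n.+1%:R * (b * x).
  by rewrite ler_piMr// mulr_ge0.
have := ler_wpM2r (addr_ge0 b0 x0) IH.
rewrite ![_ ^+ n.+2]exprSr -[n.+2%:R]natr1.
move: (b ^+ n.+1) (x ^+ n.+1) ((b + x) ^+ n.+1) (n.+1%:R : R) hb hx hs.
move=> B X C N; lra.
Qed.

Lemma is_derive_sub (f g : R -> R) (t a b : R) :
  is_derive t (1 : R) f a -> is_derive t (1 : R) g b ->
  is_derive t (1 : R) (fun s => f s - g s) (a - b).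
Proof. by move=> Df Dg; apply: (@is_deriveB _ _ _ f g). Qed.

Lemma is_derive_opp (f : R -> R) (t a : R) :
  is_derive t (1 : R) f a -> is_derive t (1 : R) (fun s => - f s) (- a).
Proof. by move=> Df; apply: (@is_deriveN _ _ _ f). Qed.

Lemma is_derive_exp_scaled (c k r : R) :
  is_derive r (1 : R) (fun r => c * expR (k * r)) (c * k * expR (k * r)).
Proof.
have D1 : is_derive r (1 : R) (fun r => k * r) k.
  by apply: is_derive_eq; rewrite /GRing.scale/= ?mulr1 ?addr0.
have D2 := is_derive1_comp (is_derive_expR (k * r)) D1.
have D3 := @is_deriveZ _ _ _ _ c _ _ _ D2.
by apply: is_derive_eq D3 _; rewrite /GRing.scale/=; ring.
Qed.

Lemma cvg_sumr (I : finType) (P : pred I) (f : I -> nat -> R) (l : I -> R) :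
  (forall i, P i -> f i n @[n --> \oo] --> l i) ->
  \sum_(i | P i) f i n @[n --> \oo] --> \sum_(i | P i) l i.
Proof.
move=> fl; apply: (@cvg_big _ _ +%R) => // x.
by apply: cvgD; [exact: cvg_fst|exact: cvg_snd].
Qed.

Lemma cvg_expr (f : nat -> R) (l : R) n :
  f N @[N --> \oo] --> l -> f N ^+ n @[N --> \oo] --> l ^+ n.
Proof.
move=> fl; elim: n => [|n IH]; first by rewrite expr0; exact: cvg_cst.
by rewrite exprS; under eq_fun do rewrite exprS; exact: cvgM.
Qed.

Lemma nneseries_le (a : nat -> R) (c : R) : (forall l, 0 <= a l) ->
  (forall n, \sum_(0 <= l < n) a l <= c) ->
  (\sum_(0 <= l <oo) (a l)%:E <= c%:E)%E.
Proof.
move=> a0 ac; apply: lime_le.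
  by apply: is_cvg_nneseries => l _ _; rewrite lee_fin.
by apply: nearW => n; rewrite sumEFin lee_fin.
Qed.

Lemma exprn_convex (s a b : R) (n : nat) : 0 <= s <= 1 -> 0 <= a -> 0 <= b ->
  ((1 - s) * a + s * b) ^+ n <= (1 - s) * a ^+ n + s * b ^+ n.
Proof.
move=> /andP[s0 s1] a0 b0; elim: n => [|n IH]; first by rewrite !expr0; lra.
have c0 : 0 <= (1 - s) * a + s * b by rewrite addr_ge0// mulr_ge0// subr_ge0.
rewrite [leLHS]exprS; apply: (le_trans (ler_wpM2l c0 IH)).
rewrite -subr_ge0.
have -> : (1 - s) * a ^+ n.+1 + s * b ^+ n.+1 -
  ((1 - s) * a + s * b) * ((1 - s) * a ^+ n + s * b ^+ n) =
  s * (1 - s) * ((a - b) * (a ^+ n - b ^+ n)) by rewrite !exprS; ring.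
apply: mulr_ge0; first by rewrite mulr_ge0// subr_ge0.
case: (lerP a b) => ab.
  by rewrite mulr_le0// subr_le0// lerXn2r.
by rewrite mulr_ge0// subr_ge0 ?lerXn2r// ltW.
Qed.

Lemma vanishing_sums (g : R -> nat -> R) :
  (forall l e, 0 < e -> exists2 T, 0 <= T & forall t, T <= t -> g t l <= e) ->
  (forall e, 0 < e -> exists L, forall t N, 0 <= t -> \sum_(L <= l < N) g t l <= e) ->
  (forall t l, 0 <= g t l) ->
  forall e, 0 < e -> exists2 T, 0 <= T &
    forall t N, T <= t -> \sum_(0 <= l < N) g t l <= e.
Proof.
move=> gv gt g0 e e0; have e2 : 0 < e / 2 by rewrite divr_gt0.
have [L HL] := gt _ e2.
have [T T0 HT] : exists2 T, 0 <= T & forall t, T <= t -> \sum_(0 <= l < L) g t l <= e / 2.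
  move: (e / 2) e2 => {HL}; elim: L => [|L IH] f f0.
    by exists 0 => // t _; rewrite big_nil ltW.
  have f2 : 0 < f / 2 by rewrite divr_gt0.
  have [T T0 HT] := IH _ f2; have [T' T0' HT'] := gv L _ f2.
  exists (Num.max T T'); first by rewrite le_max T0.
  move=> t; rewrite ge_max => /andP[tT tT']; rewrite big_nat_recr//=.
  by have := HT _ tT; have := HT' _ tT'; lra.
exists T => // t N Tt; case: (leqP L N) => LN.
  rewrite (big_cat_nat (leq0n L) LN) /=.
  by have := HT _ Tt; have := HL _ N (le_trans T0 Tt); lra.
apply: le_trans (le_trans (HT _ Tt) _); last by lra.
by rewrite [leRHS](big_cat_nat (leq0n N) (ltnW LN)) /= lerDl sumr_ge0.
Qed.

End Auxiliary.
(** * The load inequality from the graphs *)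

Section Subcritical.
Variable R : realType.

Lemma ffact_ge (a d j : nat) : (j <= d)%N -> ((a - d) ^ j <= a ^_ j)%N.
Proof.
elim: j => [|j IH] jd; first by rewrite expn0 ffactn0.
rewrite expnSr ffactnSr leq_mul//; first exact/IH/ltnW.
by rewrite leq_sub2l// ltnW.
Qed.

Lemma ffact_le (b j : nat) : (b ^_ j <= b ^ j)%N.
Proof.
by elim: j => [|j IH]; rewrite ?ffactn0// ffactnSr expnSr leq_mul// leq_subr.
Qed.

(** The probability that [d] draws without replacement all fall among [a] of
    [b] items is almost the power for draws with replacement. With truncated
    subtraction the bound is also valid, and trivial, when [a < d]. *)
Lemma bin_ratio_ge (a b d : nat) : (d <= b)%N ->
  ((a - d)%:R / b%:R) ^+ d <= 'C(a, d)%:R / 'C(b, d)%:R :> R.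
Proof.
case: d => [|d] db; first by rewrite expr0 !bin0 divff.
have b0 : (0 < b)%N by exact: leq_trans db.
have Cb : (0 < 'C(b, d.+1))%N by rewrite bin_gt0.
rewrite expr_div_n ler_pdivrMr ?exprn_gt0 ?ltr0n// mulrAC.
rewrite ler_pdivlMr ?ltr0n// -!natrX -!natrM ler_nat.
rewrite -(leq_pmul2r (fact_gt0 d.+1)) -mulnA bin_ffact mulnAC bin_ffact.
by rewrite leq_mul ?ffact_ge ?ffact_le.
Qed.

Section Dispatcher.
Variables (K M W N : nat) (G : bipartite_graph K M W N).

Definition servers_of (A : {set 'I_M}) : {set 'I_N} :=
  [set j | vtype G j \in A]%SET.

Lemma servers_ofI A m :
  servers_of A :&: Vset G m = (if m \in A then Vset G m else finset.set0) :> {set 'I_N}.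
Proof.
apply/setP => j; rewrite !inE; case: ifP => mA; rewrite !inE;
  by case: eqP => [->|_]; rewrite ?mA ?andbF.
Qed.

Lemma card_servers_ofI A i :
  #|servers_of A :&: Nw G i| = (\sum_(m in A) deg_w G i m)%N.
Proof.
rewrite -sum1_card (partition_big (vtype G) (mem A)) /=; last first.
  by move=> j; rewrite !inE => /andP[].
apply: eq_bigr => m mA; rewrite /deg_w -sum1_card; apply: eq_bigl => j.
rewrite !inE; case: eqP => [->|]; rewrite ?andbF ?andbT//.
by rewrite mA.
Qed.

Lemma deltaN_sum i : deltaN G i = (\sum_m deg_w G i m)%N.
Proof.
have := card_servers_ofI [set: 'I_M] i.
rewrite (_ : servers_of _ = [set: 'I_N]%SET); last first.
  by apply/setP => j; rewrite !inE.
by rewrite finset.setTI /deltaN => ->; apply: eq_bigl => m; rewrite !inE.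
Qed.

Lemma min_deg_w_le k m i : i \in Wset G k -> (min_deg_w G k m <= deg_w G i m)%N.
Proof.
rewrite /min_deg_w; have : i \in index_enum 'I_W by exact: mem_index_enum.
elim: (index_enum _) => [|j s IH]//; rewrite inE big_cons.
case/predU1P => [<- ->|/IH{}IH /IH{}IH]; first exact: geq_minl.
by case: ifP => // _; rewrite (leq_trans (geq_minr _ _)).
Qed.

Lemma le_max_deg_w k m i : i \in Wset G k -> (deg_w G i m <= max_deg_w G k m)%N.
Proof. by move=> iW; rewrite /max_deg_w (bigD1 i)//= leq_maxl. Qed.

Lemma edges_between_sum k m :
  #|edges_between G k m| = (\sum_(i in Wset G k) deg_w G i m)%N.
Proof.
rewrite -sum1_card (partition_big (fun e : 'I_W * 'I_N => e.1) (mem (Wset G k))) /=; last first.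
  by move=> e; rewrite !inE => /andP[_ /andP[]].
apply: eq_bigr => i iW; rewrite /deg_w -sum1_card.
rewrite (reindex_onto (fun j => (i, j)) (fun e : 'I_W * 'I_N => e.2)) /=; last first.
  by move=> [i' j] /= /andP[_ /eqP ->].
apply: eq_bigl => j; move: iW; rewrite !inE /= => ->; rewrite !eqxx !andbT.
by rewrite andbC.
Qed.

Lemma edges_between_bounds k m :
  (min_deg_w G k m * #|Wset G k| <= #|edges_between G k m|)%N /\
  (#|edges_between G k m| <= max_deg_w G k m * #|Wset G k|)%N.
Proof.
rewrite edges_between_sum; split.
  rewrite mulnC -sum_nat_const; apply: leq_sum => i; exact: min_deg_w_le.
rewrite mulnC -sum_nat_const; apply: leq_sum => i; exact: le_max_deg_w.
Qed.

Definition dispatch_term (d : nat) (lambda : R) (U : {set 'I_N}) (i : 'I_W) : R :=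
  if (d <= deltaN G i)%N
  then lambda * ('C(#|U :&: Nw G i|, d)%:R / 'C(deltaN G i, d)%:R)
  else lambda * (#|U :&: Nw G i|%:R / (deltaN G i)%:R).

(** Both cases of the definition of the load are covered: if the dispatcher has
    fewer than [d] servers the truncated difference is zero. *)
Lemma dispatch_term_ge d (lambda : R) (A : {set 'I_M}) k i : (0 < d)%N -> 0 <= lambda ->
  i \in Wset G k ->
  lambda * (((\sum_(m in A) min_deg_w G k m - d)%N)%:R /
            (\sum_m max_deg_w G k m)%N%:R) ^+ d
  <= dispatch_term d lambda (servers_of A) i.
Proof.
move=> d0 l0 iW; rewrite /dispatch_term.
set a := #|servers_of A :&: Nw G i|; set b := deltaN G i.
set a' := (\sum_(m in A) _)%N; set b' := (\sum_m _)%N.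
have aa : (a' <= a)%N.
  by rewrite /a card_servers_ofI; apply: leq_sum => m _; exact: min_deg_w_le.
have bb : (b <= b')%N.
  by rewrite /b deltaN_sum; apply: leq_sum => m _; exact: le_max_deg_w.
have ab : (a <= b)%N by apply: subset_leq_card; exact: finset.subsetIr.
case: ifPn => [db|]; last first.
  rewrite -ltnNge => bd.
  have -> : (a' - d = 0)%N.
    by apply/eqP; rewrite subn_eq0 (leq_trans aa)// (leq_trans ab)// ltnW.
  by rewrite mul0r expr0n eqn0Ngt d0 mulr0 mulr_ge0.
have b0 : (0 < b)%N by exact: leq_trans db.
rewrite ler_wpM2l//; apply: le_trans (bin_ratio_ge a db).
rewrite lerXn2r ?nnegrE ?divr_ge0//.
rewrite ler_pM ?invr_ge0 ?ler_nat ?leq_sub2r//.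
by rewrite lef_pV2 ?ler_nat ?posrE ?ltr0n// (leq_trans b0).
Qed.

Lemma rhoN_ge d (lambda : R) (u : 'I_M -> R) (A : {set 'I_M}) : (0 < d)%N -> 0 <= lambda ->
  (forall m, 0 < u m) ->
  (exists2 m, m \in A & (0 < #|Vset G m|)%N) ->
  \sum_k #|Wset G k|%:R * (lambda * (((\sum_(m in A) min_deg_w G k m - d)%N)%:R /
            (\sum_m max_deg_w G k m)%N%:R) ^+ d)
  <= rhoN G d lambda u * \sum_(m in A) u m * #|Vset G m|%:R.
Proof.
move=> d0 l0 u0 [m0 m0A V0].
have U0 : servers_of A != finset.set0.
  move: V0; rewrite card_gt0 => /set0Pn[j]; rewrite inE => /eqP jm.
  by apply/set0Pn; exists j; rewrite inE jm.
have den : \sum_(m in A) u m * #|Vset G m|%:R =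
           \sum_(m < M) u m * #|servers_of A :&: Vset G m|%:R.
  rewrite big_mkcond /=; apply: eq_bigr => m _; rewrite servers_ofI.
  by case: ifP => // _; rewrite cards0 mulr0.
have den0 : 0 < \sum_(m in A) u m * #|Vset G m|%:R.
  rewrite (bigD1 m0)//= ltr_pwDl ?mulr_gt0 ?ltr0n//.
  by rewrite sumr_ge0// => m _; rewrite mulr_ge0// ltW.
rewrite -ler_pdivrMr//; rewrite /rhoN.
apply: le_trans (le_bigmax_cond 0 (fun U : {set 'I_N} =>
  (\sum_(m < M) u m * #|U :&: Vset G m|%:R)^-1 *
  \sum_(i < W) dispatch_term d lambda U i) U0).
rewrite mulrC den ler_wpM2l ?invr_ge0 -?den ?(ltW den0)//.
rewrite (partition_big (wtype G) predT)//=; apply: ler_sum => k _.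
rewrite mulr_natl -sumr_const big_mkcond [leRHS]big_mkcond /=.
apply: ler_sum => i _; rewrite !inE; case: ifP => // ik.
by apply: dispatch_term_ge => //; rewrite inE.
Qed.

End Dispatcher.

Section FluidLimit.
Variables (K M d : nat) (lambda xi : R) (u v : 'I_M -> R) (w : 'I_K -> R).
Variables (W : nat -> nat) (G : forall N : nat, bipartite_graph K M (W N) N).
Variables (p : 'I_K -> 'I_M -> R) (rho : R).
Hypothesis hd : (0 < d)%N.
Hypothesis hlambda : 0 <= lambda.
Hypothesis hu : forall m, 0 < u m.
Hypothesis hw : forall k, 0 < w k.
Hypothesis hv : forall m, 0 < v m.
Hypothesis hW : ((W N)%:R / N%:R : R) @[N --> \oo] --> xi.
Hypothesis hWk :
  forall k, (#|Wset (G N) k|%:R / (W N)%:R : R) @[N --> \oo] --> w k.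
Hypothesis hVm : forall m, (#|Vset (G N) m|%:R / N%:R : R) @[N --> \oo] --> v m.
Hypothesis hC : condition_C G p.
Hypothesis hdelta : forall k, 0 < delta v p k.
Hypothesis hrhoN : rhoN (G N) d lambda u @[N --> \oo] --> rho.

Lemma near_ratio_gt0 (a b : nat -> nat) (l : R) : 0 < l ->
  ((a N)%:R / (b N)%:R : R) @[N --> \oo] --> l -> \forall N \near \oo, (0 < a N)%N.
Proof.
move=> l0 ab; near=> N.
have : (0 : R) < (a N)%:R / (b N)%:R by near: N; exact: (cvgr_gt l).
by case: (a N) => //; rewrite mul0r ltxx.
Unshelve. all: by end_near. Qed.

Lemma near_Wset_gt0 k : \forall N \near \oo, (0 < #|Wset (G N) k|)%N.
Proof. exact: near_ratio_gt0 (hw k) (@hWk k). Qed.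

Lemma near_Vset_gt0 m : \forall N \near \oo, (0 < #|Vset (G N) m|)%N.
Proof. exact: near_ratio_gt0 (hv m) (@hVm m). Qed.

(** The edge density controls the average degree over a type class, which lies
    between the minimum and the maximum; as their ratio tends to one, both have
    the limit of the average. *)
Lemma deg_w_cvg k m :
  ((min_deg_w (G N) k m)%:R / N%:R : R) @[N --> \oo] --> p k m * v m /\
  ((max_deg_w (G N) k m)%:R / N%:R : R) @[N --> \oo] --> p k m * v m.
Proof.
have [_ hpkm] := hC.1 k m; have [hr _] := hC.2 k m.
set r := fun N => deg_ratio R (max_deg_w (G N) k m) (min_deg_w (G N) k m) in hr.
pose avg N : R := #|edges_between (G N) k m|%:R /
  (#|Wset (G N) k|%:R * #|Vset (G N) m|%:R) * (#|Vset (G N) m|%:R / N%:R).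
have avg_cvg : avg N @[N --> \oo] --> p k m * v m by exact: cvgM.
pose squeezed N :=
  [/\ 0 < r N, (min_deg_w (G N) k m)%:R / N%:R <= avg N,
     avg N <= (max_deg_w (G N) k m)%:R / N%:R &
     (max_deg_w (G N) k m)%:R / N%:R = r N * ((min_deg_w (G N) k m)%:R / N%:R)].
have bounds : \forall N \near \oo, squeezed N.
  near=> N.
  have N0 : (0 < N)%N by near: N; exact: nbhs_infty_gt.
  have W0 : (0 < #|Wset (G N) k|)%N.
    by near: N; exact: near_Wset_gt0.
  have V0 : (0 < #|Vset (G N) m|)%N.
    by near: N; exact: near_Vset_gt0.
  have r0 : 0 < r N by near: N; exact: (cvgr_gt 1).
  rewrite /squeezed; have -> : avg N = #|edges_between (G N) k m|%:R / #|Wset (G N) k|%:R / N%:R.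
    by rewrite /avg; field; rewrite !pnatr_eq0 -!lt0n N0 W0 V0.
  have [minE maxE] := edges_between_bounds (G N) k m.
  split=> //.
  - by rewrite ler_pM2r ?invr_gt0 ?ltr0n// ler_pdivlMr ?ltr0n// -natrM ler_nat.
  - by rewrite ler_pM2r ?invr_gt0 ?ltr0n// ler_pdivrMr ?ltr0n// -natrM ler_nat.
  - rewrite mulrA; congr (_ / _); move: r0; rewrite /r /deg_ratio.
    (* A vanishing maximum forces a vanishing minimum, so [max = r * min] survives
       the convention [0 / 0 = 1]. *)
    case: eqP => [max0 _|_].
      rewrite max0 mul1r; congr _%:R; apply/esym/eqP; rewrite -leqn0 -max0.
      by rewrite -(leq_pmul2r W0) (leq_trans minE).
    have [->|min0 _] := eqVneq (min_deg_w (G N) k m) 0%N.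
      by rewrite invr0 mulr0 ltxx.
    by rewrite divfK// pnatr_eq0.
split.
- apply: (@squeeze_cvgr _ _ _ _ (fun N => avg N / r N) avg) => //.
    near=> N.
    have [r0 minE maxE maxr] : squeezed N by near: N.
    by rewrite minE andbT ler_pdivrMr// mulrC -maxr.
  rewrite -[X in _ --> X]divr1; apply: cvgM => //; apply: cvgV => //.
- apply: (@squeeze_cvgr _ _ _ _ avg (fun N => r N * avg N)) => //.
    near=> N.
    have [r0 minE maxE maxr] : squeezed N by near: N.
    by rewrite maxE /= maxr ler_pM2l.
  by rewrite -[X in _ --> X]mul1r; exact: cvgM.
Unshelve. all: by end_near. Qed.

(** The maximum defining [rhoN] is tested on the set of all servers with type in
    [A], and numerator and denominator are divided by [N]. *)
Lemma subcritical_vertices (A : {set 'I_M}) :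
  lambda * xi * \sum_k w k * (\sum_(m in A) v m * p k m / delta v p k) ^+ d
  <= rho * \sum_(m in A) u m * v m.
Proof.
have [->|/set0Pn[m0 m0A]] := eqVneq A finset.set0.
  rewrite [X in _ <= _ * X]big_set0 mulr0 big1 ?mulr0// => k _.
  by rewrite big_set0 expr0n gtn_eqF// mulr0.
pose a k N := (\sum_(m in A) min_deg_w (G N) k m)%N.
pose b k N := (\sum_m max_deg_w (G N) k m)%N.
have acvg k : ((a k N - d)%N%:R / N%:R : R) @[N --> \oo] --> \sum_(m in A) p k m * v m.
  have a0 : ((a k N)%:R / N%:R : R) @[N --> \oo] --> \sum_(m in A) p k m * v m.
    under eq_fun do rewrite natr_sum mulr_suml.
    by apply: cvg_sumr => m _; have [] := deg_w_cvg k m.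
  apply: (@squeeze_cvgr _ _ _ _ (fun N => (a k N)%:R / N%:R - d%:R / N%:R)
            (fun N => (a k N)%:R / N%:R)) => //.
    near=> N; rewrite -mulrBl !ler_pM2r ?invr_gt0 ?ltr0n; last first.
    - by near: N; exact: nbhs_infty_gt.
    - by near: N; exact: nbhs_infty_gt.
    by rewrite ler_nat leq_subr andbT lerBlDr -natrD ler_nat addnC -maxnE leq_maxr.
  rewrite -[X in _ --> X]subr0; apply: cvgB => //.
  rewrite -[X in _ --> X](mulr0 d%:R); apply: cvgM; first exact: cvg_cst.
  by apply/gtr0_cvgV0; [near=> N; rewrite ltr0n; near: N; exact: nbhs_infty_gt|exact: cvgr_idn].
have bcvg k : ((b k N)%:R / N%:R : R) @[N --> \oo] --> delta v p k.
  under eq_fun do rewrite natr_sum mulr_suml.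
  by apply: cvg_sumr => m _; have [] := deg_w_cvg k m.
pose L N : R := \sum_k (#|Wset (G N) k|%:R / (W N)%:R * ((W N)%:R / N%:R)) *
  (lambda * (((a k N - d)%N%:R / N%:R) / ((b k N)%:R / N%:R)) ^+ d).
have Lcvg : L N @[N --> \oo] --> \sum_k w k * xi *
    (lambda * ((\sum_(m in A) p k m * v m) / delta v p k) ^+ d).
  apply: cvg_sumr => k _; apply: cvgM; first exact: cvgM.
  apply: cvgM; first exact: cvg_cst.
  apply: cvg_expr; apply: cvgM => //; apply: cvgV => //.
  by rewrite gt_eqF.
pose D N : R := \sum_(m in A) u m * (#|Vset (G N) m|%:R / N%:R).
have Dcvg : D N @[N --> \oo] --> \sum_(m in A) u m * v m.
  by apply: cvg_sumr => m _; apply: cvgM => //; exact: cvg_cst.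
have -> : lambda * xi * \sum_k w k * (\sum_(m in A) v m * p k m / delta v p k) ^+ d
  = \sum_k w k * xi * (lambda * ((\sum_(m in A) p k m * v m) / delta v p k) ^+ d).
  rewrite mulr_sumr; apply: eq_bigr => k _.
  rewrite -mulr_suml (eq_bigr (fun m => p k m * v m)); last by move=> m _; rewrite mulrC.
  by ring.
apply: (ler_cvg_to Lcvg (cvgM hrhoN Dcvg)).
near=> N.
have N0 : (0 < N)%N by near: N; exact: nbhs_infty_gt.
have V0 : (0 < #|Vset (G N) m0|)%N.
  by near: N; exact: near_Vset_gt0.
have WN : forall k, (0 < #|Wset (G N) k|)%N.
  by near: N; apply: filter_forall => k; exact: near_Wset_gt0.
have Wk0 (k : 'I_K) : (0 < W N)%N.
  by have := WN k; move=> /leq_trans; apply; rewrite -[leqRHS](card_ord (W N)) max_card.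
have := rhoN_ge hd hlambda hu (ex_intro2 _ _ m0 m0A V0).
rewrite -(@ler_pM2r _ (N%:R^-1)) ?invr_gt0 ?ltr0n// => H.
apply: le_trans (le_trans H _); last first.
  rewrite -mulrA ler_wpM2l//; last first.
    by rewrite mulr_suml; apply: ler_sum => m _; rewrite mulrA.
  exact: bigmax_ge_id.
rewrite mulr_suml; apply: ler_sum => k _.
rewrite le_eqVlt; apply/orP; left; apply/eqP.
rewrite -/(a k N) -/(b k N).
have -> : (a k N - d)%:R / N%:R / ((b k N)%:R / N%:R) = (a k N - d)%:R / (b k N)%:R :> R.
  by rewrite invf_div mulrA divfK// pnatr_eq0 -lt0n.
by field; rewrite !pnatr_eq0 -!lt0n N0 Wk0.
Unshelve. all: by end_near. Qed.

End FluidLimit.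

End Subcritical.
(** * Subcriticality on the cube *)

Section MeanFieldAlgebra.
Variables (R : realType) (K M d : nat).
Variables (lambda xi : R) (u v : 'I_M -> R) (w : 'I_K -> R).
Variables (p : 'I_K -> 'I_M -> R) (rho : R).
Hypothesis hd : (1 < d)%N.
Hypothesis hlambda : 0 < lambda.
Hypothesis hxi : 0 < xi.
Hypothesis hu : forall m, 0 < u m.
Hypothesis hv : forall m, 0 < v m.
Hypothesis hw : forall k, 0 < w k.
Hypothesis hp : forall k m, 0 <= p k m.
Hypothesis hdelta : forall k, 0 < delta v p k.
Hypothesis hvert : forall A : {set 'I_M},
  lambda * xi * \sum_k w k * (\sum_(m in A) v m * p k m / delta v p k) ^+ d
  <= rho * \sum_(m in A) u m * v m.

Local Notation state := ('I_M -> nat -> R).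
Local Notation qtilde := (qtilde v p).
Local Notation rhs := (ode_rhs d lambda xi u v w p).
Implicit Types q : state.

(** The asymptotic proportion of servers of type [m] among the neighbours of a
    dispatcher of type [k]. *)
Definition share k m : R := v m * p k m / delta v p k.

Lemma share_ge0 k m : 0 <= share k m.
Proof. by rewrite /share divr_ge0// ?mulr_ge0// ltW. Qed.

Lemma share_sum1 k : \sum_m share k m = 1.
Proof.
rewrite /share -mulr_suml (eq_bigr (fun m => p k m * v m)).
  by rewrite -/(delta v p k) divff// gt_eqF.
by move=> m _; rewrite mulrC.
Qed.

(** [share k m] seen from one server: the weight [w k * share k m] is divided by
    the proportion [v m] of servers of type [m]. *)
Definition tagged_rate k m : R := p k m * w k / delta v p k.

Lemma tagged_rate_ge0 k m : 0 <= tagged_rate k m.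
Proof. by rewrite /tagged_rate divr_ge0// ?mulr_ge0// ltW. Qed.

Lemma arrival_rate_gt0 : 0 < lambda * xi. Proof. exact: mulr_gt0. Qed.

(** Convexity in each coordinate separately suffices: the coordinates are pushed
    to 0 or 1 one after the other, and a point with all coordinates in {0, 1}
    is the indicator of a set of types. *)
Lemma subcritical_cube (x : 'I_M -> R) : (forall m, 0 <= x m <= 1) ->
  lambda * xi * \sum_k w k * (\sum_m share k m * x m) ^+ d
  <= rho * \sum_m u m * v m * x m.
Proof.
move=> x01.
suff main (s : seq 'I_M) : forall x : 'I_M -> R, (forall m, 0 <= x m <= 1) ->
    (forall m, m \notin s -> x m = 0 \/ x m = 1) ->
  lambda * xi * \sum_k w k * (\sum_m share k m * x m) ^+ d
  <= rho * \sum_m u m * v m * x m.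
  by apply: (main (index_enum 'I_M)) => // m; rewrite mem_index_enum.
elim: s => [|m0 s IH] {x01}x x01 xs.
  pose A := [set m | x m == 1]%SET.
  have xA m : x m = (m \in A)%:R.
    rewrite inE; case: (xs m) => // ->; rewrite ?eqxx//.
    by rewrite eq_sym oner_eq0.
  rewrite (eq_bigr (fun k => w k * (\sum_(m in A) share k m) ^+ d)); last first.
    move=> k _; rewrite [X in _ = _ * X ^+ d]big_mkcond /=.
    congr (_ * _ ^+ d); apply: eq_bigr => m _; rewrite xA.
    by case: ifP; rewrite ?mulr1 ?mulr0.
  rewrite [X in _ <= rho * X](_ : _ = \sum_(m in A) u m * v m) ?hvert//.
  rewrite [RHS]big_mkcond /=; apply: eq_bigr => m _; rewrite xA.
  by case: ifP; rewrite ?mulr1 ?mulr0.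
pose xi0 (b : R) m := if m == m0 then b else x m.
have IH' (b : R) : b = 0 \/ b = 1 ->
  lambda * xi * \sum_k w k * (\sum_m share k m * xi0 b m) ^+ d
  <= rho * \sum_m u m * v m * xi0 b m.
  move=> b01; apply: IH => m; rewrite /xi0; case: eqP => [_|/eqP mm0] //.
    by case: b01 => ->; rewrite lexx ler01.
  by move=> ms; apply: xs; rewrite inE negb_or mm0.
have decomp (c : 'I_M -> R) : \sum_m c m * x m =
  (1 - x m0) * (\sum_m c m * xi0 0 m) + x m0 * (\sum_m c m * xi0 1 m).
  rewrite !mulr_sumr -big_split /=; apply: eq_bigr => m _; rewrite /xi0.
  by case: eqP => [->|_]; ring.
have xge0 b m : b = 0 \/ b = 1 -> 0 <= xi0 b m.
  move=> b01; rewrite /xi0; case: eqP => // _; last by case/andP: (x01 m).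
  by case: b01 => ->; rewrite // ler01.
rewrite (decomp (fun m => u m * v m)) mulrDr (mulrCA rho) (mulrCA rho).
have /andP[x0 x1] := x01 m0.
have H0 := IH' 0 (or_introl erefl); have H1 := IH' 1 (or_intror erefl).
have H0' := ler_wpM2l (_ : 0 <= 1 - x m0) H0.
have H1' := ler_wpM2l x0 H1.
apply: le_trans (lerD (H0' _) H1'); last by rewrite subr_ge0.
rewrite !(mulrCA (_ - _)) !(mulrCA (x m0)) -mulrDr ler_wpM2l ?(ltW arrival_rate_gt0)//.
rewrite !mulr_sumr -big_split /=; refine (ler_sum _ _) => k _.
rewrite !(mulrCA _ (w k)) -mulrDr ler_wpM2l ?(ltW (hw k))// decomp.
apply: exprn_convex; rewrite ?x0 ?x1// sumr_ge0// => m _.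
  by rewrite mulr_ge0 ?share_ge0// xge0//; left.
by rewrite mulr_ge0 ?share_ge0// xge0//; right.
Qed.

(** * The vector field *)

Lemma pow_quotientE (a b : R) : (a - b) * pow_quotient d a b = a ^+ d - b ^+ d.
Proof.
rewrite subrXX; congr (_ * _); rewrite /pow_quotient (reindex_inj rev_ord_inj).
apply: eq_bigr => r _ /=; rewrite -subn1 -addn1 addnC subnDA.
congr (_ * b ^+ _); have := ltn_ord r; move: hd; lia.
Qed.

Lemma pow_quotient_le (a b a' b' : R) : 0 <= a -> a <= a' -> 0 <= b -> b <= b' ->
  pow_quotient d a b <= pow_quotient d a' b'.
Proof.
move=> a0 aa b0 bb; apply: ler_sum => r _.
by rewrite ler_pM ?exprn_ge0// lerXn2r// nnegrE// (le_trans _ aa, le_trans _ bb).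
Qed.

Lemma pow_quotient_ge0 (a b : R) : 0 <= a -> 0 <= b -> 0 <= pow_quotient d a b.
Proof. by move=> a0 b0; rewrite sumr_ge0// => r _; rewrite mulr_ge0 ?exprn_ge0. Qed.

Lemma pow_quotient_le_d (a b : R) : 0 <= a <= 1 -> 0 <= b <= 1 ->
  pow_quotient d a b <= d%:R.
Proof.
move=> /andP[a0 a1] /andP[b0 b1].
rewrite -[d in d%:R]card_ord -sum1_card natr_sum; apply: ler_sum => r _.
by rewrite mulr_ile1 ?exprn_ge0// exprn_ile1.
Qed.

(** Unlike membership in S, this allows any value at level 0, so profiles are
    stable under shifts of the levels. *)
Definition profile q :=
  (forall m l, 0 <= q m l <= 1) /\ (forall m l, q m l.+1 <= q m l).

Lemma qtilde_le q q' k l : (forall m, q m l <= q' m l) -> qtilde q k l <= qtilde q' k l.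
Proof. by move=> qq; apply: ler_sum => m _; rewrite ler_wpM2l// share_ge0. Qed.

Lemma qtilde_ge0 q k l : (forall m, 0 <= q m l) -> 0 <= qtilde q k l.
Proof. by move=> q0; rewrite sumr_ge0// => m _; rewrite mulr_ge0// share_ge0. Qed.

Lemma qtilde_le1 q k l : (forall m, q m l <= 1) -> qtilde q k l <= 1.
Proof.
move=> q1; rewrite -(share_sum1 k); apply: ler_sum => m _.
by rewrite ler_piMr// share_ge0.
Qed.

Lemma qtilde01 q k l : profile q -> 0 <= qtilde q k l <= 1.
Proof.
by move=> [q01 _]; rewrite qtilde_ge0 ?qtilde_le1// => m; case/andP: (q01 m l).
Qed.

Definition join_rate q m l : R := lambda * xi *
  \sum_k tagged_rate k m * pow_quotient d (qtilde q k l.-1) (qtilde q k l).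

Lemma rhsE q m l :
  rhs q m l = - u m * (q m l - q m l.+1) + join_rate q m l * (q m l.-1 - q m l).
Proof. by rewrite /ode_rhs /join_rate; congr (_ + _); rewrite mulrAC. Qed.

(** A uniform bound for the total rate at which any coordinate leaves its value,
    hence a Lipschitz constant of a trajectory and an admissible inverse step
    for the Euler map. *)
Definition rate : R :=
  \sum_m (u m + lambda * xi * \sum_k tagged_rate k m * d%:R).

Lemma rate_term_ge0 m : 0 <= lambda * xi * \sum_k tagged_rate k m * d%:R.
Proof.
rewrite mulr_ge0 ?(ltW arrival_rate_gt0)// sumr_ge0// => k _.
by rewrite mulr_ge0 ?tagged_rate_ge0.
Qed.

Lemma le_rate m : u m + lambda * xi * \sum_k tagged_rate k m * d%:R <= rate.
Proof.
rewrite /rate (bigD1 m)//= lerDl sumr_ge0// => i _.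
by rewrite addr_ge0 ?rate_term_ge0// ltW.
Qed.

Lemma join_rate_ge0 q m l : profile q -> 0 <= join_rate q m l.
Proof.
move=> pq; rewrite mulr_ge0 ?(ltW arrival_rate_gt0)// sumr_ge0// => k _.
rewrite mulr_ge0 ?tagged_rate_ge0// pow_quotient_ge0//.
  by case/andP: (qtilde01 k l.-1 pq).
by case/andP: (qtilde01 k l pq).
Qed.

Lemma join_rate_le q m l : profile q -> u m + join_rate q m l <= rate.
Proof.
move=> pq; apply: le_trans (le_rate m); rewrite lerD2l ler_wpM2l ?(ltW arrival_rate_gt0)//.
apply: ler_sum => k _; rewrite ler_wpM2l ?tagged_rate_ge0// pow_quotient_le_d//;
exact: qtilde01.
Qed.

Lemma rhs_le q m l : profile q -> (0 < l)%N -> rhs q m l <= rate * q m l.-1.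
Proof.
move=> pq; case: l => // l _; rewrite rhsE /=.
have [q01 qd] := pq; have /andP[q0 q1] := q01 m l; have /andP[r0 r1] := q01 m l.+1.
have j0 := join_rate_ge0 m l.+1 pq; have j1 := join_rate_le m l.+1 pq.
have := qd m l; have := qd m l.+1; have := hu m => um.
nra.
Qed.

Lemma rhs_norm q m l : profile q -> (0 < l)%N -> `|rhs q m l| <= rate.
Proof.
move=> pq; case: l => // l _; rewrite rhsE /=.
have [q01 qd] := pq; have /andP[q0 q1] := q01 m l; have /andP[r0 r1] := q01 m l.+1.
have /andP[t0 t1] := q01 m l.+2.
have j0 := join_rate_ge0 m l.+1 pq; have j1 := join_rate_le m l.+1 pq.
have := qd m l; have := qd m l.+1; have := hu m => um H1 H2.
rewrite ler_norml; apply/andP; split; nra.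
Qed.

(** The coordinate itself enters with a coefficient at least [- rate]; all other
    coordinates enter with nonnegative coefficients since the
    power-of-choices factor increases in both arguments and is multiplied by
    a nonnegative difference of consecutive levels of [q']. *)
Lemma rhs_quasi_monotone q q' m l : profile q -> profile q' ->
  (forall m' l', q m' l' <= q' m' l') -> (0 < l)%N ->
  rhs q m l <= rhs q' m l + rate * (q' m l - q m l).
Proof.
move=> pq pq' qq; case: l => // l _; rewrite !rhsE /=.
have jj : join_rate q m l.+1 <= join_rate q' m l.+1.
  rewrite ler_wpM2l ?(ltW arrival_rate_gt0)//; apply: ler_sum => k _.
  rewrite ler_wpM2l ?tagged_rate_ge0// pow_quotient_le//=.
  - by case/andP: (qtilde01 k l pq).
  - exact: qtilde_le.
  - by case/andP: (qtilde01 k l.+1 pq).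
  - exact: qtilde_le.
have j0 := join_rate_ge0 m l.+1 pq; have j1 := join_rate_le m l.+1 pq.
have := pq'.2 m l; have := hu m; have := qq m l; have := qq m l.+1; have := qq m l.+2.
move: (join_rate q m l.+1) (join_rate q' m l.+1) jj j0 j1 => j j' jj j0 j1.
move: (q m l) (q m l.+1) (q m l.+2) (q' m l) (q' m l.+1) (q' m l.+2) (u m) j1.
move=> a b c a' b' c' U j1 cc bb aa U0 ba.
have h1 : j * (a' - b') <= j' * (a' - b') by rewrite ler_wpM2r// subr_ge0.
have h2 : 0 <= U * (c' - c) by rewrite mulr_ge0 ?subr_ge0// ltW.
have h3 : 0 <= j * (a' - a) by rewrite mulr_ge0 ?subr_ge0.
have h4 : 0 <= (rate - U - j) * (b' - b) by rewrite mulr_ge0 ?subr_ge0//; lra.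
lra.
Qed.

(** * Mass balance *)

(** A job joins a server holding at least [l] jobs when all [d] sampled servers
    hold that many. *)
Definition arrivals q l : R := lambda * xi * \sum_k w k * qtilde q k l ^+ d.

(** The departures from servers holding at least [l] jobs. *)
Definition services q l : R := \sum_m u m * v m * q m l.

(** Summed over the server types, the difference quotient of [x ^+ d] meets the
    increment of [qtilde] that cancels its denominator. *)
Lemma mass_balance q l : (0 < l)%N ->
  \sum_m v m * rhs q m l =
  arrivals q l.-1 - arrivals q l - (services q l - services q l.+1).
Proof.
move=> l0; rewrite addrC.
rewrite (eq_bigr (fun m => - (u m * v m * q m l - u m * v m * q m l.+1) +
  lambda * xi * \sum_k w k * (share k m * q m l.-1 - share k m * q m l) *
     pow_quotient d (qtilde q k l.-1) (qtilde q k l))); last first.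
  move=> m _; rewrite rhsE /join_rate mulrDr; congr (_ + _); first by ring.
  rewrite -(mulrA (lambda * xi)) mulrCA; congr (_ * _).
  rewrite mulr_suml mulr_sumr; apply: eq_bigr => k _.
  rewrite /tagged_rate /share; ring.
rewrite big_split /= sumrN sumrB; congr (_ + _).
rewrite -mulr_sumr /arrivals -mulrBr; congr (_ * _).
rewrite exchange_big -sumrB /=; apply: eq_bigr => k _.
rewrite -mulr_suml -mulr_sumr sumrB -mulrA pow_quotientE mulrBr //.
Qed.

Lemma arrivals_ge0 q l : (forall m, 0 <= q m l) -> 0 <= arrivals q l.
Proof.
move=> q0; rewrite mulr_ge0 ?(ltW arrival_rate_gt0)// sumr_ge0// => k _.
by rewrite mulr_ge0 ?(ltW (hw k))// exprn_ge0// qtilde_ge0.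
Qed.

Lemma arrivals_le_services q l : (forall m, 0 <= q m l <= 1) ->
  arrivals q l <= rho * services q l.
Proof. by move=> q01; exact: subcritical_cube. Qed.

(** * Existence of a fixed point *)

Section FixedPoint.
Hypothesis hM : (0 < M)%N.

Lemma rate_gt0 : 0 < rate.
Proof.
have m0 := Ordinal hM; apply: lt_le_trans (le_rate m0).
by rewrite ltr_pwDl ?rate_term_ge0.
Qed.

(** An explicit Euler step of length [1 / rate]; quasi-monotonicity makes it
    a step for which the map preserves the order. *)
Definition euler_step q : state :=
  fun m l => if l is 0%N then 1 else q m l + rhs q m l / rate.

Lemma euler_step_mono q q' m l : profile q -> profile q' ->
  (forall m' l', q m' l' <= q' m' l') -> euler_step q m l <= euler_step q' m l.
Proof.
case: l => // l pq pq' qq /=.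
have := rhs_quasi_monotone m pq pq' qq (ltn0Sn l).
rewrite /euler_step; move: (rhs q m l.+1) (rhs q' m l.+1) => f f' H.
rewrite -(ler_pM2r rate_gt0) !mulrDl !divfK ?gt_eqF ?rate_gt0//; lra.
Qed.

Lemma rhs_constant (c : R) m l : rhs (fun _ _ => c) m l = 0.
Proof. by rewrite rhsE !subrr !mulr0 addr0. Qed.

(** Constant states are fixed above level 0, which gives the bounds 0 and 1;
    monotonicity in the level is the comparison of a profile with its own
    shift, with which the field commutes. *)
Lemma euler_step_profile q : profile q -> profile (euler_step q).
Proof.
move=> pq.
have step01 m l : 0 <= euler_step q m l <= 1.
  case: l => [|l]; first by rewrite ler01 lexx.
  have pc (c : R) : 0 <= c <= 1 -> profile (fun _ _ => c) by move=> c01; split.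
  have p0 := pc 0 (introT andP (conj (lexx 0) ler01)).
  have p1 := pc 1 (introT andP (conj ler01 (lexx 1))).
  have cE (c : R) : c = euler_step (fun _ _ => c) m l.+1.
    by rewrite /euler_step rhs_constant mul0r addr0.
  apply/andP; split; [rewrite [leLHS](cE 0)|rewrite [leRHS](cE 1)];
  by apply: euler_step_mono => // m' l'; case/andP: (pq.1 m' l').
split=> // m [|l]; first by case/andP: (step01 m 1%N).
pose sq : state := fun m l => q m l.+1.
have psq : profile sq by split=> m' l'; [exact: pq.1|exact: pq.2].
exact: (@euler_step_mono sq q m l.+1 psq pq (fun m' l' => pq.2 m' l')).
Qed.

Definition empty_state : state := fun _ l => (l == 0%N)%:R.

Definition iterates n : state := iter n euler_step empty_state.

Lemma iterates_profile n : profile (iterates n).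
Proof.
elim: n => [|n IH]; last exact: euler_step_profile.
split=> m [|l] //=; rewrite /empty_state/= ?lexx ?ler01//.
Qed.

Lemma iterates_level0 n m : iterates n m 0%N = 1.
Proof. by case: n. Qed.

Lemma iterates_incr n m l : iterates n m l <= iterates n.+1 m l.
Proof.
elim: n m l => [|n IH] m l.
  case: l => // l; rewrite /iterates/= {1}/empty_state /=.
  by case/andP: ((iterates_profile 1).1 m l.+1).
by apply: euler_step_mono; [exact: iterates_profile|exact: (iterates_profile n.+1)|].
Qed.

Lemma iterates_finite n m l : (n < l)%N -> iterates n m l = 0.
Proof.
elim: n m l => [|n IH] m [|l]//= nl; rewrite -/(iterates n) rhsE /=.
have [nl1 nl2 nl3] : [/\ (n < l)%N, (n < l.+1)%N & (n < l.+2)%N] by split; lia.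
by rewrite !IH// !(subrr, mulr0, addr0, mul0r).
Qed.

Lemma rhs_iterates n m l : (0 < l)%N ->
  rhs (iterates n) m l = rate * (iterates n.+1 m l - iterates n m l).
Proof.
case: l => // l _; rewrite [iterates n.+1 m _]/= -/(iterates n) addrAC subrr add0r.
by rewrite mulrCA mulfV ?mulr1// gt_eqF// rate_gt0.
Qed.

(** An iterate is a sub-equilibrium, so [services] at [l + 1] minus
    [arrivals] at [l] is nondecreasing in [l]; beyond the occupied levels it
    is nonpositive. *)
Lemma services_le_arrivals n l : services (iterates n) l.+1 <= arrivals (iterates n) l.
Proof.
suff H i j : (n <= i + j)%N -> services (iterates n) i.+1 <= arrivals (iterates n) i.
  by apply: (H l n); exact: leq_addl.
elim: j i => [|j IH] i nij.
  rewrite /services big1 => [|m _].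
    by apply: arrivals_ge0 => m; case/andP: ((iterates_profile n).1 m i).
  by rewrite iterates_finite ?mulr0//; lia.
have : 0 <= \sum_m v m * rhs (iterates n) m i.+1.
  rewrite sumr_ge0// => m _; rewrite mulr_ge0 ?(ltW (hv m))// rhs_iterates//.
  by rewrite mulr_ge0 ?(ltW rate_gt0)// subr_ge0 iterates_incr.
have IHi : services (iterates n) i.+2 <= arrivals (iterates n) i.+1.
  by apply: IH; rewrite addSnnS.
rewrite mass_balance// succnK => H.
have aux (a b c e : R) : 0 <= a - b - (c - e) -> e <= b -> c <= a by lra.
exact: aux H IHi.
Qed.

Hypothesis hrho : rho < 1.
Hypothesis hrho0 : 0 <= rho.

(** The load inequality turns the flow inequality into a contraction by [rho]
    from one level to the next. *)
Lemma services_iterates n l :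
  services (iterates n) l <= rho ^+ l * \sum_m u m * v m.
Proof.
elim: l => [|l IH].
  rewrite expr0 mul1r le_eqVlt; apply/orP; left; apply/eqP.
  by apply: eq_bigr => m _; rewrite iterates_level0 mulr1.
apply: (le_trans (services_le_arrivals n l)).
apply: (le_trans (arrivals_le_services (fun m => (iterates_profile n).1 m l))).
by rewrite exprS -mulrA ler_wpM2l.
Qed.

Lemma iterates_le n m l :
  iterates n m l <= (\sum_m u m * v m) / (u m * v m) * rho ^+ l.
Proof.
have uv : 0 < u m * v m by exact: mulr_gt0.
rewrite mulrAC ler_pdivlMr// mulrC [leRHS]mulrC.
apply: le_trans (services_iterates n l).
rewrite /services (bigD1 m)//= lerDl sumr_ge0// => i _.
apply: mulr_ge0; first by rewrite mulr_ge0// ltW.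
by case/andP: ((iterates_profile n).1 i l).
Qed.

Definition qlim : state := fun m l => limn (fun n => iterates n m l).

Lemma iterates_cvg m l : iterates n m l @[n --> \oo] --> qlim m l.
Proof.
apply: nondecreasing_is_cvgn.
  by apply/nondecreasing_seqP => n; exact: iterates_incr.
by exists 1 => _ [n _ <-]; case/andP: ((iterates_profile n).1 m l).
Qed.

Lemma qlim_le (c : R) m l : (forall n, iterates n m l <= c) -> qlim m l <= c.
Proof.
move=> H; apply: limr_le; first exact: (cvgP _ (@iterates_cvg m l)).
by apply: nearW.
Qed.

Lemma qlim01 m l : 0 <= qlim m l <= 1.
Proof.
apply/andP; split; last first.
  by apply: qlim_le => n; case/andP: ((iterates_profile n).1 m l).
apply: limr_ge; first exact: (cvgP _ (@iterates_cvg m l)).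
by apply: nearW => n; case/andP: ((iterates_profile n).1 m l).
Qed.

Lemma qlim_in_S : in_S qlim.
Proof.
move=> m; split.
- exact: qlim01.
- rewrite /qlim; under eq_fun do rewrite iterates_level0.
  by apply: lim_cst.
- move=> l; apply: (ler_cvg_to (@iterates_cvg m l.+1) (@iterates_cvg m l)).
  by apply: nearW => n; exact: (iterates_profile n).2.
set c := (\sum_m u m * v m) / (u m * v m).
have c0 : 0 <= c.
  rewrite divr_ge0// ?mulr_ge0// ?(ltW (hu m)) ?(ltW (hv m))//.
  by rewrite sumr_ge0// => i _; rewrite mulr_ge0// ltW.
apply: (@le_lt_trans _ _ (c / (1 - rho))%:E); last exact: ltry.
apply: nneseries_le => [l|n]; first by case/andP: (qlim01 m l).
apply: (@le_trans _ _ (\sum_(0 <= l < n) c * rho ^+ l)).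
  by apply: ler_sum => l _; apply: qlim_le => i; exact: iterates_le.
rewrite -mulr_sumr ler_wpM2l// big_mkord -[leRHS]mul1r ler_pdivlMr ?subr_gt0//.
have -> : (\sum_(i < n) rho ^+ i) * (1 - rho) = 1 - rho ^+ n.
  rewrite -[1 - rho]opprB mulrN mulrC -subrX1; ring.
by rewrite lerBlDr lerDl exprn_ge0.
Qed.

(** Each coordinate of the field involves finitely many coordinates of the
    state, so coordinatewise convergence is enough. *)
Lemma rhs_cvg (q : nat -> state) (q' : state) m l :
  (forall m l, q n m l @[n --> \oo] --> q' m l) ->
  rhs (q n) m l @[n --> \oo] --> rhs q' m l.
Proof.
move=> qq.
have tq k i : qtilde (q n) k i @[n --> \oo] --> qtilde q' k i.
  by apply: cvg_sumr => m' _; apply: cvgM; [exact: cvg_cst|exact: qq].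
apply: cvgD; first by apply: cvgM; [exact: cvg_cst|apply: cvgB; exact: qq].
apply: cvgM.
  by apply: cvgM; [exact: cvg_cst|apply: cvgB; exact: qq].
apply: cvg_sumr => k _; apply: cvgM; first exact: cvg_cst.
by apply: cvg_sumr => r _; apply: cvgM; apply: cvg_expr; exact: tq.
Qed.

Lemma qlim_fixed : is_fixed_point d lambda xi u v w p qlim.
Proof.
move=> m; split; first by have [_] := qlim_in_S m.
move=> l l0.
have c1 : rhs (iterates n) m l @[n --> \oo] --> rhs qlim m l.
  by apply: rhs_cvg => m' l'; exact: iterates_cvg.
have c2 : rhs (iterates n) m l @[n --> \oo] --> rate * (qlim m l - qlim m l).
  under eq_fun do rewrite rhs_iterates//.
  apply: cvgM; first exact: cvg_cst.
  apply: cvgB; last exact: iterates_cvg.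
  by have := @iterates_cvg m l; rewrite -cvg_shiftS.
by rewrite (cvg_unique _ c1 c2) // subrr mulr0.
Qed.

End FixedPoint.

Lemma in_S_profile q : in_S q -> profile q.
Proof. by move=> Sq; split=> m l; have [] := Sq m. Qed.

Lemma in_S_bounded q : in_S q ->
  exists c, forall n, \sum_(0 <= l < n) \sum_m q m l <= c.
Proof.
move=> Sq; pose s m := limn (series (q m)).
exists (\sum_m s m) => n; rewrite exchange_big /=; apply: ler_sum => m _.
have [q01 _ _ qs] := Sq m.
have q0 l : 0 <= q m l by case/andP: (q01 l).
apply: (@nondecreasing_cvgn_le _ (series (q m))).
  by apply/nondecreasing_seqP => k; rewrite /series/= big_nat_recr//= lerDl.
exact: nnseries_is_cvg.
Qed.

Lemma rate_ge0 : 0 <= rate.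
Proof. by rewrite sumr_ge0// => m _; rewrite addr_ge0 ?rate_term_ge0// ltW. Qed.

(** A constant for which the [qtilde] of a nonnegative state is controlled by its
    [services], independently of the state. *)
Definition gap_rate : R :=
  lambda * xi * \sum_k w k * \sum_m share k m / (u m * v m).

Lemma gap_rate_ge0 : 0 <= gap_rate.
Proof.
rewrite mulr_ge0 ?(ltW arrival_rate_gt0)// sumr_ge0// => k _; rewrite mulr_ge0 ?(ltW (hw k))//.
by rewrite sumr_ge0// => m _; rewrite divr_ge0 ?share_ge0// mulr_ge0// ltW.
Qed.

Lemma qtilde_le_gap_rate q l : (forall m, 0 <= q m l) ->
  lambda * xi * \sum_k w k * qtilde q k l <= gap_rate * services q l.
Proof.
move=> q0; rewrite /gap_rate -(mulrA (lambda * xi)) ler_wpM2l ?(ltW arrival_rate_gt0)// mulr_suml.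
apply: ler_sum => k _; rewrite -(mulrA (w k)) ler_wpM2l ?(ltW (hw k))// mulr_suml.
apply: ler_sum => m _; rewrite -/(share k m) -(mulrA (share k m)) ler_wpM2l ?share_ge0//.
have uv : 0 < u m * v m by exact: mulr_gt0.
rewrite mulrC ler_pdivlMr// mulrC /services (bigD1 m)//= lerDl sumr_ge0// => i _.
by apply: mulr_ge0 => //; rewrite mulr_ge0// ltW.
Qed.

(** * Estimates for one solution *)

Section Solution.
Variables (q0 : state) (q : R -> state).
Hypothesis hq : is_solution d lambda xi u v w p q0 q.

Lemma sol_profile t : 0 <= t -> profile (q t).
Proof. by move=> t0; apply: in_S_profile; have [_ S _ _] := hq; exact: S. Qed.

Lemma sol_lipschitz m l s t : 0 <= s -> s <= t ->
  `|q t m l - q s m l| <= rate * (t - s).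
Proof.
move=> s0 st; case: l => [|l].
  have [_ S _ _] := hq.
  have [_ e _ _] := S t (le_trans s0 st) m; have [_ e' _ _] := S s s0 m.
  by rewrite e e' subrr normr0 mulr_ge0 ?rate_ge0// subr_ge0.
have [_ _ C D] := hq.
have bnd r : s < r -> `|rhs (q r) m l.+1| <= rate.
  move=> sr; apply: rhs_norm => //; apply: sol_profile.
  by apply: (le_trans s0); exact: ltW.
rewrite ler_norml; apply/andP; split.
- have Dn r : s < r -> r < t -> right_slope_le (fun r => - q r m l.+1) r rate.
    move=> sr rt; apply: (@right_slope_le_weaken _ _ _ (- rhs (q r) m l.+1)).
      by apply: le_trans (bnd r sr); rewrite -normrN ler_norm.
    apply: right_slope_le_derive; apply: is_derive_opp.
    by apply: D => //; exact: le_lt_trans sr.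
  have Cn : {within `[0, +oo[, continuous (fun r => - q r m l.+1)}.
    by move=> x; apply: cvgN; exact: C.
  have := slope_le_growth Cn s0 st Dn; lra.
- have Dn r : s < r -> r < t -> right_slope_le (fun r => q r m l.+1) r rate.
    move=> sr rt; apply: (@right_slope_le_weaken _ _ _ (rhs (q r) m l.+1)).
      by apply: le_trans (bnd r sr); rewrite ler_norm.
    apply: right_slope_le_derive.
    by apply: D => //; exact: le_lt_trans sr.
  have := slope_le_growth (C m l.+1) s0 st Dn; lra.
Qed.

(** Coordinates at level [l + 1] are fed at rate at most [rate] by level [l].
    Inductively, with the exponential rate [2 * rate], each level adds half of
    the previous bound to its own initial value. The high levels therefore stay
    negligible uniformly on bounded time intervals. *)
Lemma tail_growth : exists2 z : nat -> R, (forall l, 0 <= z l) /\ z l @[l --> \oo] --> 0 &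
  forall t m l, 0 <= t -> q t m l <= z l * expR (2 * rate * t).
Proof.
have [q00 Sq C D] := hq.
have S0 : in_S q0 by rewrite -q00; exact: Sq.
have [c cb] := in_S_bounded S0.
pose b l := \sum_m q0 m l.
have q0ge m l : 0 <= q0 m l by case/andP: ((in_S_profile S0).1 m l).
have b0 l : 0 <= b l by rewrite sumr_ge0.
have q0b m l : q0 m l <= b l by rewrite /b (bigD1 m)//= lerDl sumr_ge0.
pose z := fix z l := if l is l'.+1 then b l'.+1 + z l' / 2 else b 0%N.
have [zge zc] := @halving_cvg0 _ b c z b0 cb erefl (fun=> erefl).
exists z => // t m l; elim: l t => [|l IH] t t0.
  have [_ -> _ _] := Sq t t0 m; have [_ e _ _] := S0 m.
  have e1 : 1 <= expR (2 * rate * t).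
    by rewrite -expR0 ler_expR mulr_ge0// mulr_ge0// rate_ge0.
  have := q0b m 0%N; rewrite e => h; apply: (le_trans h).
  by rewrite -[leLHS]mulr1 ler_wpM2l.
pose g r := q r m l.+1 - (z l / 2) * expR (2 * rate * r).
have gc : {within `[0, +oo[, continuous g}.
  move=> x; apply: cvgB; first exact: C.
  apply: cvgM; first exact: cvg_cst.
  apply: (@continuous_comp _ _ _ (fun r : subspace _ => 2 * rate * r : R) expR); last exact: continuous_expR.
  by apply: continuous_subspaceT => {}x; apply: cvgM; [exact: cvg_cst|exact: cvg_id].
have gs r : 0 < r -> r < t -> right_slope_le g r 0.
  move=> r0 rt.
  have de : is_derive r (1 : R) (fun r => (z l / 2) * expR (2 * rate * r))
     (z l * rate * expR (2 * rate * r)).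
    apply: is_derive_eq (is_derive_exp_scaled _ _ _) _.
    by field.
  have dg := is_derive_sub (D m l.+1 (ltn0Sn l) r r0) de.
  apply: right_slope_le_weaken (right_slope_le_derive dg).
  rewrite subr_le0; apply: (le_trans (rhs_le m (sol_profile (ltW r0)) (ltn0Sn l))).
  by rewrite -mulrA mulrCA ler_wpM2l ?rate_ge0// IH// ltW.
have := slope_le_growth gc (lexx 0) t0 gs.
rewrite /g mul0r addr0 mulr0 expR0 mulr1 q00 => H.
have e1 : 1 <= expR (2 * rate * t).
  by rewrite -expR0 ler_expR mulr_ge0// mulr_ge0// rate_ge0.
have zl := zge l; have qb := q0b m l.+1; have bl := b0 l.+1.
move: H => /=; rewrite -/(b l.+1).
have h1 : 0 <= b l.+1 * (expR (2 * rate * t) - 1) by rewrite mulr_ge0// subr_ge0.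
lra.
Qed.

End Solution.

(** * The excess of one solution over another *)

Section Comparison.
Variables (q0 q0' : state) (q q' : R -> state).
Hypothesis hq : is_solution d lambda xi u v w p q0 q.
Hypothesis hq' : is_solution d lambda xi u v w p q0' q'.

Definition excess t : state := fun m l => Num.max (q t m l - q' t m l) 0.
Definition joint t : state := fun m l => Num.max (q t m l) (q' t m l).

(** The rate at which the total excess over the levels from [l] on is served. *)
Definition gap t l : R := services (excess t) l.

Lemma joint_profile t : 0 <= t -> profile (joint t).
Proof.
move=> t0; have [a b] := sol_profile hq t0; have [a' b'] := sol_profile hq' t0.
split=> m l; rewrite /joint.
  have /andP[x0 x1] := a m l; have /andP[y0 y1] := a' m l.
  by rewrite le_max x0 ge_max x1 y1.
by rewrite ge_max !le_max b b' orbT.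
Qed.

Lemma excess_ge0 t m l : 0 <= excess t m l.
Proof. by rewrite /excess le_max lexx orbT. Qed.

Lemma excess_le t m l : 0 <= t -> excess t m l <= q t m l.
Proof.
move=> t0; have /andP[x0 x1] := (sol_profile hq t0).1 m l.
have /andP[y0 y1] := (sol_profile hq' t0).1 m l.
by rewrite /excess ge_max x0 andbT gerBl.
Qed.

Lemma jointE t m l : joint t m l = q' t m l + excess t m l.
Proof. by rewrite /joint /excess addr_maxr addr0 addrC subrK. Qed.

Lemma excess_level0 t m : 0 <= t -> excess t m 0%N = 0.
Proof.
move=> t0; have [_ S _ _] := hq; have [_ S' _ _] := hq'.
have [_ e _ _] := S t t0 m; have [_ e' _ _] := S' t t0 m.
by rewrite /excess e e' subrr maxxx.
Qed.

Lemma gap_ge0 t l : 0 <= gap t l.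
Proof.
rewrite /gap /services sumr_ge0// => m _.
by apply: mulr_ge0; [rewrite mulr_ge0// ltW|exact: excess_ge0].
Qed.

Lemma gap_joint t l : gap t l = services (joint t) l - services (q' t) l.
Proof.
rewrite /gap /services -sumrB; apply: eq_bigr => m _; rewrite jointE; ring.
Qed.

(** The part of the flow into the levels above [l] that is due to the excess. *)
Definition surplus t l : R := arrivals (joint t) l - arrivals (q' t) l.

Lemma qtilde_joint t k l : qtilde (joint t) k l = qtilde (q' t) k l + qtilde (excess t) k l.
Proof.
by rewrite /Defs.qtilde -big_split /=; apply: eq_bigr => m _; rewrite jointE mulrDr.
Qed.

Lemma surplus_ge0 t l : 0 <= t -> 0 <= surplus t l.
Proof.
move=> t0; rewrite subr_ge0 ler_wpM2l ?(ltW arrival_rate_gt0)//; apply: ler_sum => k _.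
have /andP[b0 _] := qtilde01 k l (sol_profile hq' t0).
have /andP[j0 _] := qtilde01 k l (joint_profile t0).
rewrite ler_wpM2l ?(ltW (hw k))// lerXn2r ?nnegrE//.
by apply: qtilde_le => m; rewrite /joint le_max lexx orbT.
Qed.

(** Level 0 is full in both solutions, so no excess enters from below. *)
Lemma surplus_level0 t : 0 <= t -> surplus t 0 = 0.
Proof.
move=> t0; rewrite /surplus /arrivals -mulrBr -sumrB big1 ?mulr0// => k _.
rewrite qtilde_joint [qtilde (excess t) k 0]big1 ?addr0 ?subrr// => m _.
by rewrite excess_level0// mulr0.
Qed.

Lemma qtilde_excess_bounds t k l : 0 <= t ->
  [/\ 0 <= qtilde (q' t) k l, 0 <= qtilde (excess t) k l,
    qtilde (q' t) k l + qtilde (excess t) k l <= 1 & qtilde (q' t) k l <= 1].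
Proof.
move=> t0; have /andP[b0 b1] := qtilde01 k l (sol_profile hq' t0).
rewrite -qtilde_joint; have /andP[_ j1] := qtilde01 k l (joint_profile t0).
by split=> //; apply: qtilde_ge0 => m; exact: excess_ge0.
Qed.

Lemma surplus_le t l : 0 <= t -> surplus t l <= d%:R * gap_rate * gap t l.
Proof.
move=> t0; rewrite -mulrA; apply: (@le_trans _ _
  (d%:R * (lambda * xi * \sum_k w k * qtilde (excess t) k l))).
  rewrite /surplus /arrivals -mulrBr mulrCA ler_wpM2l ?(ltW arrival_rate_gt0)//.
  rewrite -sumrB mulr_sumr; apply: ler_sum => k _.
  rewrite -mulrBr mulrCA ler_wpM2l ?(ltW (hw k))// qtilde_joint.
  have [b0 x0 bx b1] := qtilde_excess_bounds k l t0.
  rewrite -pow_quotientE addrAC subrr add0r mulrC ler_wpM2r//.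
  by apply: pow_quotient_le_d; rewrite ?b0 ?b1 ?bx ?addr_ge0.
by rewrite ler_wpM2l// qtilde_le_gap_rate// => m; exact: excess_ge0.
Qed.

(** The load inequality applied to the excess itself gives the factor [rho]; the
    error is bilinear in the excess and in the reference solution. *)
Lemma surplus_le_sharp t l : 0 <= t ->
  surplus t l <= (rho + 2 * d%:R * gap_rate * \sum_m q' t m l) * gap t l.
Proof.
move=> t0; set B := \sum_m q' t m l.
have qB k : qtilde (q' t) k l <= B.
  apply: ler_sum => m _; rewrite -/(share k m) ler_piMl//.
    by case/andP: ((sol_profile hq' t0).1 m l).
  rewrite -(share_sum1 k) (bigD1 m)//= lerDl sumr_ge0// => i _; exact: share_ge0.
have B0 : 0 <= B.
  by rewrite sumr_ge0// => m _; case/andP: ((sol_profile hq' t0).1 m l).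
have e01 m : 0 <= excess t m l <= 1.
  rewrite excess_ge0 (le_trans (excess_le m l t0))//.
  by case/andP: ((sol_profile hq t0).1 m l).
rewrite mulrDl; apply: (@le_trans _ _ (arrivals (excess t) l +
   2 * d%:R * B * (lambda * xi * \sum_k w k * qtilde (excess t) k l))); last first.
  apply: lerD; first exact: arrivals_le_services.
  have -> : 2 * d%:R * gap_rate * B * gap t l = (2 * d%:R * B) * (gap_rate * gap t l).
    by ring.
  apply: ler_wpM2l; first by rewrite mulr_ge0// mulr_ge0.
  by rewrite qtilde_le_gap_rate// => m; exact: excess_ge0.
rewrite /surplus /arrivals -mulrBr mulrCA -mulrDr ler_wpM2l ?(ltW arrival_rate_gt0)//.
rewrite -sumrB mulr_sumr -big_split /=; apply: ler_sum => k _.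
rewrite -mulrBr (mulrCA _ (w k)) -mulrDr ler_wpM2l ?(ltW (hw k))// qtilde_joint.
have [b0 x0 bx b1] := qtilde_excess_bounds k l t0.
have := @pow_increment _ _ _ d.-1 b0 x0 bx; rewrite prednK ?(ltnW hd)//.
move/le_trans; apply; rewrite lerD2l mulrA ler_wpM2r// ler_wpM2l//.
Qed.

(** Where [q] is above [q'] it coincides with [joint], and elsewhere [q'] does;
    in both cases the other coordinates of [joint] are at least as large. *)
Lemma excess_slope t m l : 0 < t -> (0 < l)%N ->
  right_slope_le (fun s => excess s m l) t
    (rhs (joint t) m l - rhs (q' t) m l).
Proof.
move=> t0 l0; have t0' := ltW t0.
have [_ _ _ D] := hq; have [_ _ _ D'] := hq'.
have d1 := D m l l0 t t0; have d2 := D' m l l0 t t0.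
have pj := joint_profile t0'; have pq := sol_profile hq t0'; have pq' := sol_profile hq' t0'.
apply: (@right_slope_le_pos _ (fun s => q s m l - q' s m l) t
  (rhs (q t) m l - rhs (q' t) m l) _ (is_derive_sub d1 d2)).
- rewrite subr_ge0 => qq; rewrite lerD2r.
  have := @rhs_quasi_monotone _ _ m l pq pj _ l0.
  have -> : joint t m l = q t m l by rewrite /joint max_l.
  rewrite subrr mulr0 addr0; apply => m' l'.
  by rewrite /joint le_max lexx.
- rewrite subr_le0 => qq; rewrite subr_ge0.
  have := @rhs_quasi_monotone _ _ m l pq' pj _ l0.
  have -> : joint t m l = q' t m l by rewrite /joint max_r.
  rewrite subrr mulr0 addr0; apply => m' l'.
  by rewrite /joint le_max lexx orbT.
Qed.

(** * Weighted excess as a Lyapunov functional *)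

Section Lyapunov.
Variables (a c r : nat -> R) (n : nat).
Hypothesis a_ge0 : forall l, 0 <= a l.
Hypothesis c_ge0 : forall l, 0 <= c l.
Hypothesis a_finite : forall l, (n < l)%N -> a l = 0.
Hypothesis a_super : forall l, r l.+1 * a l.+1 + c l <= a l.
Hypothesis surplus_r : forall t l, 0 <= t ->
  surplus t l.+1 <= r l.+1 * gap t l.+1.

(** Level [l.+1] has weight [theta l], so that summation by parts against the
    telescoping drift leaves the weights [a]. *)
Definition theta l : R := \sum_(j < l.+1) a j.
Definition mass t l : R := \sum_m v m * excess t m l.
Definition lyapunov N t : R := \sum_(l < N) theta l * mass t l.+1.
Definition drain t N : R := \sum_(l < N) c l * gap t l.+1.

Lemma theta_ge0 l : 0 <= theta l.
Proof. by rewrite sumr_ge0. Qed.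

Lemma mass_ge0 t l : 0 <= mass t l.
Proof. by rewrite sumr_ge0// => m _; rewrite mulr_ge0 ?excess_ge0// ltW. Qed.

Lemma weight_le N : \sum_(j < N) a j <= \sum_(j < n.+1) a j.
Proof.
rewrite -!(big_mkord predT).
case: (leqP N n.+1) => [Nn|nN].
  rewrite [leRHS](big_cat_nat (leq0n N) Nn) /= lerDl big_seq sumr_ge0// => l _.
rewrite [leLHS](big_cat_nat (leq0n _) (ltnW nN)) /= gerDl big_seq big1// => l.
by rewrite mem_index_iota => /andP[nl _]; exact: a_finite.
Qed.

Lemma lyapunovE N t : lyapunov N t =
  \sum_(i : 'I_N * 'I_M) (theta i.1 * v i.2) * excess t i.2 i.1.+1.
Proof.
rewrite -(pair_bigA _ (fun (l : 'I_N) (m : 'I_M) => theta l * v m * excess t m l.+1)) /=.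
by apply: eq_bigr => l _; rewrite mulr_sumr; apply: eq_bigr => m _; rewrite mulrA.
Qed.

(** Summation by parts, after which the weighted inflow at each level is absorbed
    by the outflow one level below. What remains at the cutoff is the flow
    from level [N.+1] into the retained levels. *)
Lemma lyapunov_slope N t : 0 < t -> right_slope_le (lyapunov N) t
  ((\sum_(j < N) a j) * gap t N.+1 - drain t N).
Proof.
move=> t0; have t0' := ltW t0.
rewrite (_ : lyapunov N = fun s =>
   \sum_(i : 'I_N * 'I_M) (theta i.1 * v i.2) * excess s i.2 i.1.+1); last first.
  by apply/funext => s; exact: lyapunovE.
have H := @right_slope_le_sum R ('I_N * 'I_M)%type (fun i s => excess s i.2 i.1.+1)
  (fun i => theta i.1 * v i.2)
  (fun i => rhs (joint t) i.2 i.1.+1 - rhs (q' t) i.2 i.1.+1) t.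
apply: right_slope_le_weaken (H _ _); last 2 first.
- by move=> i; rewrite mulr_ge0 ?theta_ge0// ltW.
- by move=> i; exact: excess_slope.
pose h l := surplus t l - gap t l.+1.
have -> : \sum_(i : 'I_N * 'I_M) theta i.1 * v i.2 *
     (rhs (joint t) i.2 i.1.+1 - rhs (q' t) i.2 i.1.+1)
   = \sum_(l < N) theta l * (h l - h l.+1).
  rewrite -(pair_bigA _ (fun (l : 'I_N) (m : 'I_M) => theta l * v m *
     (rhs (joint t) m l.+1 - rhs (q' t) m l.+1))) /=.
  apply: eq_bigr => l _.
  rewrite (eq_bigr (fun m => theta l * (v m * rhs (joint t) m l.+1 -
      v m * rhs (q' t) m l.+1))); last by move=> m _; ring.
  rewrite -mulr_sumr sumrB !mass_balance//=; congr (_ * _).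
  by rewrite /h !gap_joint /surplus; ring.
rewrite summation_by_parts /h.
have -> : \sum_(l < N) a l * (surplus t l - gap t l.+1) =
   \sum_(l < N) a l * surplus t l - \sum_(l < N) a l * gap t l.+1.
  by rewrite -sumrB; apply: eq_bigr => l _; rewrite mulrBr.
have h1 : \sum_(l < N) a l * surplus t l <= \sum_(l < N) a l.+1 * surplus t l.+1.
  apply: (@le_trans _ _ (\sum_(l < N.+1) a l * surplus t l)).
    by rewrite big_ord_recr/= lerDl mulr_ge0// surplus_ge0.
  by rewrite big_ord_recl/= surplus_level0// mulr0 add0r.
have h2 : \sum_(l < N) a l.+1 * surplus t l.+1 + drain t N <= \sum_(l < N) a l * gap t l.+1.
  rewrite /drain -big_split /=; apply: ler_sum => l _.
  apply: (@le_trans _ _ ((r l.+1 * a l.+1 + c l) * gap t l.+1)).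
    rewrite mulrDl lerD2r (mulrC (r _)) -mulrA ler_wpM2l//; exact: surplus_r.
  by rewrite ler_wpM2r ?gap_ge0.
have h3 : 0 <= (\sum_(j < N) a j) * surplus t N.
  by rewrite mulr_ge0 ?sumr_ge0 ?surplus_ge0.
rewrite mulrBr; lra.
Qed.

Lemma lyapunov_continuous N : {within `[0, +oo[, continuous (lyapunov N)}.
Proof.
rewrite (_ : lyapunov N = fun s =>
   \sum_(i : 'I_N * 'I_M) (theta i.1 * v i.2) * excess s i.2 i.1.+1); last first.
  by apply/funext => s; exact: lyapunovE.
have [_ _ C _] := hq; have [_ _ C' _] := hq'.
apply: (@within_lincomb R ('I_N * 'I_M)%type _ (fun i => theta i.1 * v i.2)
  (fun i s => excess s i.2 i.1.+1)) => i.
by apply: within_pos => x; apply: cvgB; [exact: C|exact: C'].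
Qed.

(** The cutoff error vanishes as [N] grows because the high levels are
    negligible on bounded time intervals. *)
Lemma lyapunov_growth : exists2 err : R -> nat -> R,
  (forall t, err t N @[N --> \oo] --> 0) &
  forall N y s t, 0 <= s -> s <= t ->
   (forall x, s <= x -> x <= t -> y <= drain x N) ->
   lyapunov N t <= lyapunov N s + (err t N - y) * (t - s).
Proof.
have [z [z0 zc] qz] := tail_growth hq.
pose U := \sum_m u m * v m; pose A := \sum_(j < n.+1) a j.
exists (fun t N => A * U * expR (2 * rate * t) * z N.+1).
  move=> t; rewrite -[X in _ --> X](mulr0 (A * U * expR (2 * rate * t))).
  by apply: cvgM; [exact: cvg_cst|rewrite (@cvg_shiftS _ z)].
move=> N y s t s0 st yd.
apply: slope_le_growth => //; first exact: lyapunov_continuous.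
move=> x sx xt; have x0 : 0 < x by exact: le_lt_trans sx.
apply: right_slope_le_weaken (lyapunov_slope N x0).
apply: lerB; last by apply: yd; exact: ltW.
have U0 : 0 <= U by rewrite sumr_ge0// => m _; rewrite mulr_ge0// ltW.
apply: (@le_trans _ _ (A * gap x N.+1)).
  by rewrite ler_wpM2r ?gap_ge0// weight_le.
rewrite -(mulrA A) -(mulrA A) -(mulrA U); apply: ler_wpM2l; first by rewrite sumr_ge0.
rewrite /gap /services mulr_suml; apply: ler_sum => m _.
apply: ler_wpM2l; first by rewrite mulr_ge0// ltW.
apply: (le_trans (excess_le _ _ (ltW x0))); apply: (le_trans (qz _ _ _ (ltW x0))).
rewrite mulrC ler_wpM2r// ler_expR ler_wpM2l ?(ltW xt)//.
by rewrite mulr_ge0 ?rate_ge0.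
Qed.

Lemma mass_summable t : 0 <= t ->
  exists X, forall N, \sum_(0 <= l < N) mass t l.+1 <= X.
Proof.
move=> t0; have [_ S _ _] := hq; have [X HX] := in_S_bounded (S t t0).
exists ((\sum_m v m) * X) => N; apply: (@le_trans _ _
  ((\sum_m v m) * \sum_(0 <= l < N) \sum_m q t m l.+1)).
  rewrite mulr_sumr; apply: ler_sum => l _.
  rewrite mulr_suml; apply: ler_sum => m _; rewrite ler_wpM2l ?(ltW (hv m))//.
  apply: (le_trans (excess_le _ _ t0)); rewrite (bigD1 m)//= lerDl sumr_ge0// => i _.
  by case/andP: ((sol_profile hq t0).1 i l.+1).
rewrite ler_wpM2l//; first by rewrite sumr_ge0// => m _; exact: ltW.
apply: le_trans (HX N.+1); rewrite [leRHS]big_nat_recl//= lerDr sumr_ge0// => i _.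
by case/andP: ((sol_profile hq t0).1 i 0%N).
Qed.

Definition lyapunov_lim t : R := limn (fun N => lyapunov N t).

Lemma lyapunov_nondecr t N N' : (N <= N')%N -> lyapunov N t <= lyapunov N' t.
Proof.
move=> NN; rewrite /lyapunov -!(big_mkord predT (fun l => theta l * mass t l.+1)).
rewrite [leRHS](big_cat_nat (leq0n _) NN) /= lerDl sumr_ge0// => l _.
by rewrite mulr_ge0 ?theta_ge0 ?mass_ge0.
Qed.

Lemma lyapunov_bounded t : 0 <= t -> exists X, forall N, lyapunov N t <= X.
Proof.
move=> t0; have [X HX] := mass_summable t0.
exists ((\sum_(j < n.+1) a j) * X) => N.
apply: le_trans (ler_wpM2l _ (HX N)); last by rewrite sumr_ge0.
rewrite big_mkord mulr_sumr; apply: ler_sum => l _.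
by rewrite ler_wpM2r ?mass_ge0// weight_le.
Qed.

Lemma lyapunov_cvg t : 0 <= t -> lyapunov N t @[N --> \oo] --> lyapunov_lim t.
Proof.
move=> t0; have [X HX] := lyapunov_bounded t0.
apply: nondecreasing_is_cvgn; first by move=> i j; exact: lyapunov_nondecr.
by exists X => _ [N _ <-].
Qed.

Lemma lyapunov_le_lim t N : 0 <= t -> lyapunov N t <= lyapunov_lim t.
Proof.
move=> t0; apply: (@nondecreasing_cvgn_le _ (lyapunov ^~ t)).
  by move=> i j; exact: lyapunov_nondecr.
by apply: cvgP (lyapunov_cvg t0).
Qed.

Lemma drain_nondecr t N N' : (N <= N')%N -> drain t N <= drain t N'.
Proof.
move=> NN; rewrite /drain -!(big_mkord predT (fun l => c l * gap t l.+1)).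
rewrite [leRHS](big_cat_nat (leq0n _) NN) /= lerDl sumr_ge0// => l _.
by rewrite mulr_ge0 ?gap_ge0.
Qed.

Lemma lyapunov_lim_growth y N0 s t : 0 <= s -> s <= t ->
  (forall x, s <= x -> x <= t -> y <= drain x N0) ->
  lyapunov_lim t <= lyapunov_lim s - y * (t - s).
Proof.
move=> s0 st yd; have t0 := le_trans s0 st.
have [err errc G] := lyapunov_growth.
have R1 : lyapunov N s + (err t N - y) * (t - s) @[N --> \oo] -->
   lyapunov_lim s + (0 - y) * (t - s).
  apply: cvgD; first exact: lyapunov_cvg.
  apply: cvgM; last exact: cvg_cst.
  by apply: cvgB; [exact: errc|exact: cvg_cst].
rewrite -mulNr -[- y]add0r; apply: (ler_cvg_to (lyapunov_cvg t0) R1).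
near=> N; apply: G => // x sx xt; apply: (le_trans (yd x sx xt)).
by apply: drain_nondecr; near: N; exact: nbhs_infty_ge.
Unshelve. all: by end_near. Qed.

End Lyapunov.

(** * Vanishing gaps and uniform tails *)

Lemma gap_lipschitz l s t : 0 <= s -> s <= t ->
  `|gap t l - gap s l| <= (2 * rate * (\sum_m u m * v m) + 1) * (t - s).
Proof.
move=> s0 st.
have pos_lip (x y : R) : `|Num.max x 0 - Num.max y 0| <= `|x - y|.
  rewrite !maxr_absE !subr0 !addr0 -mulrBl normrM [`|2^-1|]gtr0_norm ?invr_gt0//.
  rewrite ler_pdivrMr// mulr_natr mulr2n.
  rewrite opprD addrACA; apply: (le_trans (ler_normD _ _)); rewrite lerD2l.
  exact: ler_dist_dist.
have ex m : `|excess t m l - excess s m l| <= 2 * rate * (t - s).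
  apply: (le_trans (pos_lip _ _)).
  have -> : q t m l - q' t m l - (q s m l - q' s m l) =
            (q t m l - q s m l) - (q' t m l - q' s m l) by ring.
  apply: (le_trans (ler_normB _ _)); rewrite -mulrA mulr_natl mulr2n.
  by apply: lerD; [exact: (sol_lipschitz hq)|exact: (sol_lipschitz hq')].
have st0 : 0 <= t - s by rewrite subr_ge0.
apply: (@le_trans _ _ ((2 * rate * \sum_m u m * v m) * (t - s))); last first.
  by rewrite ler_wpM2r// lerDl.
rewrite /gap /services -sumrB; apply: (le_trans (ler_norm_sum _ _ _)).
rewrite mulr_sumr mulr_suml; apply: ler_sum => m _.
rewrite -mulrBr normrM ger0_norm ?mulr_ge0 ?(ltW (hu m)) ?(ltW (hv m))//.
by rewrite (mulrC (2 * rate)) -[leRHS]mulrA ler_wpM2l// mulr_ge0// ltW.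
Qed.

(** The geometric weights compensate the crude constant in [surplus_le] level by
    level, and the sudden drop to 0 after level [n] leaves a genuine
    dissipation of the gap there. *)
Lemma gap_vanishes n e : 0 < e ->
  exists2 T, 0 <= T & forall t, T <= t -> gap t n.+1 <= e.
Proof.
pose B := d%:R * gap_rate.
have B0 : 0 <= B by rewrite mulr_ge0 ?gap_rate_ge0.
pose a l : R := if (l <= n)%N then (B + 1) ^+ (n - l) else 0.
pose c l : R := (l == n)%:R.
have a0 l : 0 <= a l by rewrite /a; case: ifP => // _; rewrite exprn_ge0// addr_ge0.
have c0 l : 0 <= c l by rewrite /c.
have afin l : (n < l)%N -> a l = 0 by move=> nl; rewrite /a [(l <= n)%N]leqNgt nl.
have asup l : B * a l.+1 + c l <= a l.
  rewrite /a /c; case: (ltngtP l n) => [ln|nl|->].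
  - by rewrite addr0 -(subnSK ln) exprS ler_wpM2r ?exprn_ge0 ?addr_ge0// lerDl.
  - by rewrite mulr0 addr0.
  - by rewrite mulr0 add0r subnn expr0.
have sr t l : 0 <= t -> surplus t l.+1 <= B * gap t l.+1 by exact: surplus_le.
have L0 : 0 < 2 * rate * (\sum_m u m * v m) + 1.
  rewrite ltr_wpDl// mulr_ge0 ?mulr_ge0 ?rate_ge0// sumr_ge0// => m _.
  by rewrite mulr_ge0// ltW.
move=> e0; apply: (@dissipation_vanishes _ (lyapunov_lim a) (gap ^~ n.+1) _ L0) => //.
- move=> t t0; apply: le_trans (lyapunov_le_lim a0 afin 0 t0).
  by rewrite /lyapunov big_ord0.
- by move=> t _; exact: gap_ge0.
- by move=> s t; exact: gap_lipschitz.
move=> y s t y0 s0 st yg.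
apply: (@lyapunov_lim_growth a c (fun=> B) n a0 c0 afin asup sr y n.+1 s t s0 st) => x sx xt.
apply: (le_trans (yg x sx xt)).
rewrite /drain big_ord_recr /= /c eqxx mul1r lerDr sumr_ge0// => l _.
by rewrite mulr_ge0 ?gap_ge0.
Qed.

(** With weights at least 1 up to [n], levels beyond [n] have weight at least
    [n.+1] in the functional. Its initial value is at most [e * n.+1]: the
    levels below a fixed [L] contribute a bounded amount and those above it a
    small multiple of [n.+1]. *)
Lemma excess_tail (r : nat -> R) (B : R) (l0 : nat) : 0 <= B ->
  (forall l, 0 <= r l.+1) ->
  (forall l, r l.+1 <= B) -> (forall l, (l0 <= l)%N -> r l.+1 <= 1) ->
  (forall t l, 0 <= t -> surplus t l.+1 <= r l.+1 * gap t l.+1) ->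
  forall e, 0 < e -> exists L, forall t N, 0 <= t ->
    \sum_(L <= l < N) mass t l.+1 <= e.
Proof.
move=> B0 r0 rB r1 sr e e0.
pose A := (B + 1) ^+ l0.
have B1 : 1 <= B + 1 by rewrite lerDr.
have A1 : 1 <= A by rewrite exprn_ege1.
have [X HX] := mass_summable (lexx (0:R)).
have eA : 0 < e / (2 * A) by rewrite divr_gt0// mulr_gt0//; exact: lt_le_trans A1.
have m0 t l : 0 <= mass t l.+1 by exact: mass_ge0.
have [L HL] := bounded_series_tail (m0 0) HX eA.
have X0 : 0 <= X by have := HX 0%N; rewrite big_nil.
have [n Hn] : exists n : nat, A * (L%:R * X) <= (e / 2) * n.+1%:R.
  exists (Num.bound (A * (L%:R * X) / (e / 2))).
  rewrite [leRHS]mulrC -ler_pdivrMr ?divr_gt0//.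
  have := archi_boundP (_ : 0 <= A * (L%:R * X) / (e / 2)).
  rewrite divr_ge0 ?mulr_ge0// ?(ltW e0)// ?(le_trans ler01 A1)// => /(_ isT) /ltW h.
  by apply: (le_trans h); rewrite ler_nat.
(* The truncated exponent makes the weights constant from [l0] on. *)
pose a l : R := if (l <= n)%N then (B + 1) ^+ (l0 - l) else 0.
have a1 l : (l <= n)%N -> 1 <= a l by rewrite /a => ->; rewrite exprn_ege1.
have a0 l : 0 <= a l by rewrite /a; case: ifP => // _; rewrite exprn_ge0// addr_ge0.
have aA l : a l <= A.
  rewrite /a; case: ifP => _; last exact: le_trans ler01 A1.
  by rewrite /A ler_weXn2l// leq_subr.
have afin l : (n < l)%N -> a l = 0 by move=> nl; rewrite /a [(l <= n)%N]leqNgt nl.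
have c0 (l : nat) : 0 <= (0 : R) by [].
have asup l : r l.+1 * a l.+1 + 0 <= a l.
  rewrite addr0 /a; case: ifP => [ln|_]; last by rewrite mulr0; exact: a0.
  rewrite (ltnW ln); case: (leqP l0 l) => ll0.
    have -> : (l0 - l = 0)%N by apply/eqP; rewrite subn_eq0.
    have -> : (l0 - l.+1 = 0)%N by apply/eqP; rewrite subn_eq0 leqW.
    by rewrite expr0 mulr1 r1.
  rewrite -(subnSK ll0) exprS ler_wpM2r ?exprn_ge0 ?addr_ge0//.
  by apply: (le_trans (rB l)); rewrite lerDl.
exists n => t N t0.
have N1 : 0 < n.+1%:R :> R by rewrite ltr0n.
rewrite -(ler_pM2l N1).
apply: (@le_trans _ _ (lyapunov a N t)).
  rewrite mulr_sumr /lyapunov -(big_mkord predT (fun l => theta a l * mass t l.+1)).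
  case: (leqP n N) => nN; last first.
    rewrite [leLHS]big_geq ?(ltnW nN)//; apply: sumr_ge0 => l _.
    by rewrite mulr_ge0// theta_ge0.
  rewrite [leRHS](big_cat_nat (leq0n n) nN) /=.
  rewrite -[leLHS]add0r; apply: lerD.
    by apply: sumr_ge0 => l _; rewrite mulr_ge0// theta_ge0.
  rewrite big_nat [leRHS]big_nat; apply: ler_sum => l /andP[nl _].
  rewrite ler_wpM2r// /theta -(big_mkord predT a).
  rewrite (big_cat_nat (leq0n n.+1) (nl : (n.+1 <= l.+1)%N)) /=.
  apply: (@le_trans _ _ (\sum_(0 <= j < n.+1) a j)); last first.
    by rewrite lerDl sumr_ge0.
  apply: (@le_trans _ _ (\sum_(0 <= j < n.+1) 1)); first by rewrite sumr_const_nat subn0.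
  by rewrite big_nat [leRHS]big_nat; apply: ler_sum => j /andP[_ jn]; exact: a1.
apply: (le_trans (lyapunov_le_lim a0 afin N t0)).
have := @lyapunov_lim_growth a (fun=> 0) r n a0 c0 afin asup sr 0 0 0 t (lexx 0) t0.
rewrite mul0r subr0 => H; apply: (le_trans (H _)).
  by move=> x _ _; rewrite /drain big_ord0.
apply: (ler_cvg_to (lyapunov_cvg a0 afin (lexx 0)) (cvg_cst _)).
apply: nearW => N'.
have thetaA l k : (forall N, \sum_(j < N) a j <= \sum_(j < k) a j) \/ (l < k)%N ->
    theta a l <= A * k%:R.
  move=> Hk; apply: (@le_trans _ _ (\sum_(j < k) a j)).
    case: Hk => [Hk|lk]; first exact: Hk.
    rewrite /theta -!(big_mkord predT a) [leRHS](big_cat_nat (leq0n _) lk) /=.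
    by rewrite lerDl sumr_ge0.
  apply: (@le_trans _ _ (\sum_(j < k) A)); first by apply: ler_sum => j _.
  by rewrite sumr_const card_ord mulr_natr.
have A0 : 0 <= A by exact: le_trans ler01 A1.
have low k : (k <= L)%N ->
    \sum_(0 <= l < k) theta a l * mass 0 l.+1 <= (e / 2) * n.+1%:R.
  move=> kL; apply: le_trans Hn.
  apply: (@le_trans _ _ (\sum_(0 <= l < k) A * L%:R * mass 0 l.+1)).
    rewrite big_nat [leRHS]big_nat; apply: ler_sum => l /andP[_ lk].
    by rewrite ler_wpM2r// thetaA//; right; exact: leq_trans kL.
  by rewrite -mulr_sumr mulrA ler_wpM2l// mulr_ge0.
have high k : \sum_(L <= l < k) theta a l * mass 0 l.+1 <= (e / 2) * n.+1%:R.
  apply: (@le_trans _ _ (\sum_(L <= l < k) A * n.+1%:R * mass 0 l.+1)).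
    apply: ler_sum => l _; rewrite ler_wpM2r// thetaA//; left => N''.
    exact: weight_le.
  rewrite -mulr_sumr; apply: le_trans (ler_wpM2l _ (HL k)) _; first by rewrite mulr_ge0.
  rewrite le_eqVlt; apply/orP; left; apply/eqP; field.
  by rewrite gt_eqF// (lt_le_trans _ A1).
rewrite /lyapunov -(big_mkord predT (fun l => theta a l * mass 0 l.+1)).
have halves : (e / 2) * n.+1%:R + (e / 2) * n.+1%:R = n.+1%:R * e by field.
rewrite -halves; case: (leqP L N') => LN; last first.
  by apply: (le_trans (low N' (ltnW LN))); rewrite lerDl mulr_ge0// divr_ge0// ltW.
by rewrite (big_cat_nat (leq0n L) LN) /= lerD// low.
Qed.

End Comparison.

(** * Convergence to the fixed point *)

Section Convergence.
Variable qs : state.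
Hypothesis hS : in_S qs.
Hypothesis hfix : is_fixed_point d lambda xi u v w p qs.
Hypothesis hrho : rho < 1.
Hypothesis hrho0 : 0 <= rho.

Lemma fixed_point_solution (q : state) : in_S q ->
  is_fixed_point d lambda xi u v w p q ->
  is_solution d lambda xi u v w p q (fun=> q).
Proof.
move=> Sq fq; split=> // [m l|m l l0 t t0]; first by move=> x; exact: cvg_cst.
by have [_ /(_ l l0) ->] := fq m; exact: is_derive_cst.
Qed.

Lemma mass_le_gap (q q' : R -> state) t l :
  mass q q' t l <= (\sum_m (u m)^-1) * gap q q' t l.
Proof.
rewrite mulr_suml; apply: ler_sum => m _.
have e0 i : 0 <= u i * v i * excess q q' t i l.
  by apply: mulr_ge0; [rewrite mulr_ge0// ltW|exact: excess_ge0].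
rewrite [leRHS]mulrC ler_pdivlMr// mulrC mulrA /gap /services (bigD1 m)//= lerDl.
by rewrite sumr_ge0.
Qed.

Lemma mass_vanishes q0 q0' (q q' : R -> state) :
  is_solution d lambda xi u v w p q0 q -> is_solution d lambda xi u v w p q0' q' ->
  forall l e, 0 < e -> exists2 T, 0 <= T & forall t, T <= t -> mass q q' t l <= e.
Proof.
move=> hq hq' [|l] e e0.
  exists 0 => // t t0; rewrite /mass big1 ?ltW// => m _.
  by rewrite (excess_level0 hq hq') ?mulr0.
pose U := \sum_m (u m)^-1 + 1.
have U1 : \sum_m (u m)^-1 <= U by rewrite lerDl.
have U0 : 0 < U by rewrite ltr_wpDl// sumr_ge0// => m _; rewrite invr_ge0 ltW.
have [T T0 HT] := gap_vanishes hq hq' l (divr_gt0 e0 U0).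
exists T => // t Tt; apply: (le_trans (mass_le_gap _ _ _ _)).
apply: (@le_trans _ _ (U * gap q q' t l.+1)); first by rewrite ler_wpM2r ?gap_ge0.
by rewrite mulrC -ler_pdivlMr// HT.
Qed.

(** The constant in [surplus_le_sharp] tends to [rho < 1] along the levels since
    the fixed point is summable. *)
Lemma excess_above_tail q0 (q : R -> state) : is_solution d lambda xi u v w p q0 q ->
  forall e, 0 < e -> exists L, forall t N, 0 <= t ->
    \sum_(L <= l < N) mass q (fun=> qs) t l <= e.
Proof.
move=> hq e e0; have hs := fixed_point_solution hS hfix.
have [c Hc] := in_S_bounded hS.
pose b l := \sum_m qs m l.
have qs01 := (in_S_profile hS).1.
have b0 l : 0 <= b l by rewrite sumr_ge0// => m _; case/andP: (qs01 m l).
have bM l : b l <= M%:R.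
  rewrite -[M in M%:R]card_ord -sum1_card natr_sum; apply: ler_sum => m _.
  by case/andP: (qs01 m l).
have bc : b l @[l --> \oo] --> 0 by exact: bounded_series_cvg0 Hc.
pose C := 2 * d%:R * gap_rate.
have C0 : 0 <= C by rewrite mulr_ge0 ?gap_rate_ge0// mulr_ge0.
pose r l := rho + C * b l.
have rc : r l @[l --> \oo] --> rho + C * 0.
  by apply: cvgD; [exact: cvg_cst|apply: cvgM; [exact: cvg_cst|exact: bc]].
have [l0 _ Hl0] : \forall l \near \oo, r l < 1.
  by apply: (cvgr_lt _ rc); rewrite mulr0 addr0.
have [||||| L HL] := @excess_tail q0 qs q (fun=> qs) hq hs r (rho + C * M%:R) l0 _ _ _ _ _ e e0.
- by rewrite addr_ge0// mulr_ge0.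
- by move=> l; rewrite addr_ge0// mulr_ge0.
- by move=> l; rewrite lerD2l ler_wpM2l.
- by move=> l l0l; apply/ltW/Hl0 => /=; exact: leqW.
- by move=> t l t0; exact: (surplus_le_sharp hq hs).
exists L.+1 => t N t0; rewrite big_add1; exact: HL.
Qed.

Lemma excess_below_tail q0 (q : R -> state) : is_solution d lambda xi u v w p q0 q ->
  forall e, 0 < e -> exists L, forall t N, 0 <= t ->
    \sum_(L <= l < N) mass (fun=> qs) q t l <= e.
Proof.
move=> hq e e0; have hs := fixed_point_solution hS hfix.
have [c Hc] := in_S_bounded hS; have qs01 := (in_S_profile hS).1.
pose V := \sum_m v m + 1.
have V0 : 0 < V by rewrite ltr_wpDl// sumr_ge0// => m _; exact: ltW.
have [||L HL] := @bounded_series_tail R (fun l => \sum_m qs m l) c (e / V) _ Hc.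
- by move=> l; rewrite sumr_ge0// => m _; case/andP: (qs01 m l).
- by rewrite divr_gt0.
exists L => t N t0; apply: (@le_trans _ _ (V * \sum_(L <= l < N) \sum_m qs m l)).
  rewrite mulr_sumr; apply: ler_sum => l _; rewrite mulr_sumr; apply: ler_sum => m _.
  apply: ler_pM; rewrite ?excess_ge0 ?(ltW (hv m))//; last exact: (excess_le hs hq).
  by rewrite /V (bigD1 m)//= -addrA lerDl addr_ge0// sumr_ge0// => i _; exact: ltW.
by rewrite mulrC -ler_pdivlMr.
Qed.

Lemma convergence_sums q0 (q : R -> state) : is_solution d lambda xi u v w p q0 q ->
  forall e, 0 < e -> exists2 T, 0 <= T & forall t m N, T <= t ->
    \sum_(0 <= l < N) `|q t m l - qs m l| <= e / v m.
Proof.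
move=> hq e e0; have hs := fixed_point_solution hS hfix.
pose g t l := mass q (fun=> qs) t l + mass (fun=> qs) q t l.
have g0 t l : 0 <= g t l by rewrite addr_ge0 ?mass_ge0.
have [||T T0 HT] := @vanishing_sums R g _ _ g0 e e0.
- move=> l f f0; have f2 : 0 < f / 2 by rewrite divr_gt0.
  have [T T0 HT] := mass_vanishes hq hs l f2.
  have [T' T0' HT'] := mass_vanishes hs hq l f2.
  exists (Num.max T T'); first by rewrite le_max T0.
  move=> t; rewrite ge_max => /andP[tT tT'].
  by have := HT _ tT; have := HT' _ tT'; rewrite /g; lra.
- move=> f f0; have f2 : 0 < f / 2 by rewrite divr_gt0.
  have [L HL] := excess_above_tail hq f2.
  have [L' HL'] := excess_below_tail hq f2.
  exists (maxn L L') => t N t0; rewrite big_split /=.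
  have tl (h : nat -> R) (k k' : nat) : (forall l, 0 <= h l) -> (k <= k')%N ->
      \sum_(k' <= l < N) h l <= \sum_(k <= l < N) h l.
    move=> h0 kk; case: (leqP k' N) => kN.
      by rewrite [leRHS](big_cat_nat kk kN) /= lerDr sumr_ge0.
    by rewrite big_geq ?(ltnW kN)// sumr_ge0.
  have := tl _ _ _ (mass_ge0 q (fun=> qs) t) (leq_maxl L L').
  have := tl _ _ _ (mass_ge0 (fun=> qs) q t) (leq_maxr L L').
  by have := HL t N t0; have := HL' t N t0; lra.
exists T => // t m N Tt; rewrite ler_pdivlMr//; apply: le_trans (HT t N Tt).
rewrite mulr_suml; apply: ler_sum => l _.
have absE (x : R) : `|x| = Num.max x 0 + Num.max (- x) 0.
  by rewrite !maxr_absE !subr0 !addr0 normrN; field.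
rewrite absE opprB mulrC mulrDr; apply: lerD;
  rewrite /mass (bigD1 m)//= lerDl sumr_ge0// => i _;
  by rewrite mulr_ge0 ?excess_ge0// ltW.
Qed.

Lemma l1_convergence q0 (q : R -> state) : is_solution d lambda xi u v w p q0 q ->
  l1_dist (q t) qs @[t --> +oo] --> 0%E.
Proof.
move=> hq.
have bound e : 0 < e -> \forall t \near +oo, (l1_dist (q t) qs <= (e * \sum_m (v m)^-1)%:E)%E.
  move=> e0; have [T T0 HT] := convergence_sums hq e0.
  near=> t; rewrite /l1_dist mulr_sumr -sumEFin; apply: lee_sum => m _.
  apply: nneseries_le => // n; apply: HT.
  near: t; apply: nbhs_pinfty_ge; exact: num_real.
have l1ge t : (0 <= l1_dist (q t) qs)%E.
  apply: sume_ge0 => m _; apply: nneseries_ge0 => l _ _; by rewrite lee_fin.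
apply/fine_cvgP; split.
  have := bound 1 ltr01; apply: filterS => t H.
  by rewrite ge0_fin_numE//; exact: le_lt_trans H (ltry _).
apply/cvgrPdist_le => e e0.
pose V := \sum_m (v m)^-1 + 1.
have V0 : 0 < V by rewrite ltr_wpDl// sumr_ge0// => m _; rewrite invr_ge0 ltW.
have := bound (e / V) (divr_gt0 e0 V0); apply: filterS => t H.
have fin : l1_dist (q t) qs \is a fin_num.
  by rewrite ge0_fin_numE//; exact: le_lt_trans H (ltry _).
rewrite sub0r normrN ger0_norm ?fine_ge0// -lee_fin fineK//.
apply: (le_trans H); rewrite lee_fin mulrAC ler_pdivrMr// ler_wpM2l ?(ltW e0)//.
by rewrite lerDl.
Unshelve. all: by end_near. Qed.

(** The constant trajectory at another fixed point must converge to [qs]. *)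
Lemma fixed_point_unique (q : state) : in_S q ->
  is_fixed_point d lambda xi u v w p q -> qs = q.
Proof.
move=> Sq fq; have hq := fixed_point_solution Sq fq.
apply/funext => m; apply/funext => l; apply/eqP; rewrite eq_sym -subr_eq0 -normr_le0.
apply/ler_addgt0Pr => e e0; rewrite add0r.
have [T T0 HT] := convergence_sums hq (mulr_gt0 e0 (hv m)).
have := HT T m l.+1 (lexx T); rewrite mulfK ?gt_eqF// big_nat_recr//=.
by apply: le_trans; rewrite lerDr sumr_ge0.
Qed.

End Convergence.

(** With all types selected the load inequality compares [lambda * xi > 0] with
    a multiple of [rho]. *)
Lemma subcritical_constant_gt0 : \sum_k w k = 1 -> 0 < rho.
Proof.
move=> hw1; have := hvert [set: 'I_M].
rewrite (eq_bigr w); last first.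
  move=> k _; rewrite (eq_bigl predT) => [|m]; last by rewrite inE.
  by rewrite share_sum1 expr1n mulr1.
rewrite hw1 mulr1 => H; have := lt_le_trans arrival_rate_gt0 H.
apply: contraTT; rewrite -!leNgt => r0; rewrite mulr_le0_ge0// sumr_ge0// => m _.
by rewrite mulr_ge0// ltW.
Qed.

End MeanFieldAlgebra.

(** * Existence, uniqueness and global stability *)

Theorem theorem3p11 (R : realType) (K M d : nat)
  (hK : (1 <= K)%N) (hM : (1 <= M)%N) (hd : (2 <= d)%N)
  (lambda xi : R) (u : 'I_M -> R) (w : 'I_K -> R) (v : 'I_M -> R)
  (hlambda : 0 < lambda) (hxi : 0 < xi) (hu : forall m, 0 < u m)
  (hw : forall k, 0 < w k <= 1) (hw1 : \sum_(k < K) w k = 1)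
  (hv : forall m, 0 < v m <= 1) (hv1 : \sum_(m < M) v m = 1)
  (hload : lambda * xi < \sum_(m < M) u m * v m)
  (W : nat -> nat) (G : forall N : nat, bipartite_graph K M (W N) N)
  (hW : ((W N)%:R / N%:R : R) @[N --> \oo] --> xi)
  (hWk : forall k, (#|Wset (G N) k|%:R / (W N)%:R : R) @[N --> \oo] --> w k)
  (hVm : forall m, (#|Vset (G N) m|%:R / N%:R : R) @[N --> \oo] --> v m)
  (p : 'I_K -> 'I_M -> R)
  (hC : condition_C G p)
  (hdelta : forall k, 0 < delta v p k)
  (rho : R) (hrho : rho < 1)
  (hrhoN : rhoN (G N) d lambda u @[N --> \oo] --> rho) :
  exists qstar : 'I_M -> nat -> R,
    unique (fun q => in_S q /\ is_fixed_point d lambda xi u v w p q) qstar /\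
    forall (q0 : 'I_M -> nat -> R), in_S q0 ->
    forall (qbar : R -> 'I_M -> nat -> R),
      is_solution d lambda xi u v w p q0 qbar ->
      l1_dist (qbar t) qstar @[t --> +oo] --> 0%E.
Proof.
have hw0 k : 0 < w k by case/andP: (hw k).
have hv0 m : 0 < v m by case/andP: (hv m).
have hp k m : 0 <= p k m by have [/andP[]] := hC.1 k m.
have hvert (A : {set 'I_M}) := @subcritical_vertices R K M d lambda xi u v w W G p rho
  (ltnW hd) (ltW hlambda) hu hw0 hv0 hW hWk hVm hC hdelta hrhoN A.
have hrho0 := ltW (subcritical_constant_gt0 hlambda hxi hu hv0 hdelta hvert hw1).
have Sq := qlim_in_S hd hlambda hxi hu hv0 hw0 hp hdelta hvert hM hrho hrho0.
have Fq := qlim_fixed hd hlambda hxi hu hv0 hw0 hp hdelta hvert hM hrho hrho0.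
exists (qlim d lambda xi u v w p); split.
  split=> // q [Sq' Fq'].
  exact: (fixed_point_unique hd hlambda hxi hu hv0 hw0 hp hdelta hvert Sq Fq hrho hrho0 Sq' Fq').
move=> q0 _ q hq.
exact: (l1_convergence hd hlambda hxi hu hv0 hw0 hp hdelta hvert Sq Fq hrho hrho0 hq).
Qed.
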